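(* Let $\mathcal H$ be a separable Hilbert space, let $F\in R[\mathcal H]$, let $z_0\in\mathbb C_+$ and let $a\in\mathbb R$. Then the following equivalences hold: (1) $0\in\sigma_p(\operatorname{Im}F(z_0))$ if and only if $0\in\sigma_p(\operatorname{Im}F(z))$ for all $z\in\mathbb C_+$; (2) $0\in\sigma_c(\operatorname{Im}F(z_0))$ if and only if $0\in\sigma_c(\operatorname{Im}F(z))$ for all $z\in\mathbb C_+$; (3) $0\in\rho(\operatorname{Im}F(z_0))$ if and only if $0\in\rho(\operatorname{Im}F(z))$ for all $z\in\mathbb C_+$; (4) $a\in\sigma_p(F(z_0))$ if and only if $a\in\sigma_p(F(z))$ for all $z\in\mathbb C_+$; (5) $a\in\sigma_c(F(z_0))$ if and only if $a\in\sigma_c(F(z))$ for all $z\in\mathbb C_+$; (6) $a\in\rho(F(z_0))$ if and only if $a\in\rho(F(z))$ for all $z\in\mathbb C_+$.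
   Context: $\mathcal B(\mathcal H)$ is the set of bounded everywhere defined linear operators on $\mathcal H$; $\mathbb C_\pm$ are the open upper/lower half-planes. For $T\in\mathcal B(\mathcal H)$ put $\operatorname{Im}T=\frac1{2i}(T-T^* )$; $T$ is called dissipative (accumulative) if $\operatorname{Im}T\ge 0$ ($\operatorname{Im}T\le 0$). The class $R[\mathcal H]$ consists of all operator functions $F$, holomorphic on $\mathbb C\setminus\mathbb R$ with values in $\mathcal B(\mathcal H)$, such that (i) $F(z)$ is dissipative for $z\in\mathbb C_+$ and accumulative for $z\in\mathbb C_-$; (ii) $F(z)^*=F(\bar z)$ for $z\in\mathbb C\setminus\mathbb R$. $\sigma_p,\sigma_c,\rho$ denote the point spectrum (eigenvalues), the continuous spectrum (points $\lambda$ for which $T-\lambda$ is injective with dense range different from $\mathcal H$), and the resolvent set. *)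

(* Defs.v *)
From Stdlib Require Import Reals Lra Psatz ClassicalEpsilon.
From Coquelicot Require Import Coquelicot.

Open Scope R_scope.

(** [inner] is linear in the first argument.  Definiteness of [inner] and
    completeness come from [CompleteNormedModule]. *)
Record HilbertSpace := {
  hilbert_space :> CompleteNormedModule C_AbsRing;
  inner : hilbert_space -> hilbert_space -> C;
  inner_plus_l : forall x y z,
    inner (plus x y) z = (inner x z + inner y z)%C;
  inner_scal_l : forall (k : C) x y,
    inner (scal k x) y = (k * inner x y)%C;
  inner_conj : forall x y, inner y x = Cconj (inner x y);
  inner_norm : forall x, inner x x = RtoC (norm x ^ 2)
}.

Arguments inner {_} _ _.

Definition separable (H : HilbertSpace) : Prop :=
  exists u : nat -> H, forall (x : H) (eps : posreal),
    exists n, norm (minus (u n) x) < eps.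

(** Coquelicot's [is_linear] includes boundedness. *)
Record BOp (H : HilbertSpace) := {
  op_fun :> H -> H;
  op_linear : is_linear op_fun
}.

Arguments op_fun {_} _ _.
Arguments op_linear {_} _.

Section Operators.
Context {H : HilbertSpace}.
Implicit Types (x y z u v : H) (T : BOp H).

Local Notation rin x y := (Re (inner x y)).

Lemma inner_plus_r x y z : inner x (plus y z) = (inner x y + inner x z)%C.
Proof.
  rewrite (inner_conj _ (plus y z) x), inner_plus_l.
  rewrite (inner_conj _ y x), (inner_conj _ z x).
  apply injective_projections; simpl; ring.
Qed.

Lemma inner_scal_r (k : C) x y : inner x (scal k y) = (Cconj k * inner x y)%C.
Proof.
  rewrite (inner_conj _ (scal k y) x), inner_scal_l, (inner_conj _ y x).
  apply injective_projections; simpl; ring.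
Qed.

Lemma opp_scal x : opp x = scal (- (1))%C x.
Proof. symmetry. exact (scal_opp_one x). Qed.

Lemma norm_compat1H x y (eps : R) : norm (minus y x) < eps -> ball x eps y.
Proof. exact (norm_compat1 x y eps). Qed.

Lemma norm_compat2H x y (eps : posreal) :
  ball x eps y -> norm (minus y x) < @norm_factor _ (hilbert_space H) * eps.
Proof. exact (norm_compat2 x y eps). Qed.

Lemma norm_oppH x : norm (opp x) = norm x.
Proof. exact (norm_opp x). Qed.

Lemma norm_geH x : 0 <= norm x.
Proof. exact (norm_ge_0 x). Qed.

Lemma norm_triangleH x y : norm (plus x y) <= norm x + norm y.
Proof. exact (norm_triangle x y). Qed.

Lemma norm_triangle_minusH x y : norm (minus x y) <= norm x + norm y.
Proof. rewrite <- (norm_oppH y). exact (norm_triangleH x (opp y)). Qed.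

Lemma inner_opp_l x y : inner (opp x) y = (- inner x y)%C.
Proof.
  rewrite opp_scal, inner_scal_l.
  apply injective_projections; simpl; ring.
Qed.

Lemma inner_opp_r x y : inner x (opp y) = (- inner x y)%C.
Proof.
  rewrite opp_scal, inner_scal_r.
  apply injective_projections; simpl; ring.
Qed.

Lemma inner_minus_l x y z : inner (minus x y) z = (inner x z - inner y z)%C.
Proof. unfold minus; now rewrite inner_plus_l, inner_opp_l. Qed.

Lemma inner_minus_r x y z : inner x (minus y z) = (inner x y - inner x z)%C.
Proof. unfold minus; now rewrite inner_plus_r, inner_opp_r. Qed.

Lemma rin_sym x y : rin x y = rin y x.
Proof. now rewrite (inner_conj _ y x). Qed.

Lemma rin_norm x : rin x x = norm x ^ 2.
Proof. now rewrite inner_norm. Qed.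

Lemma norm_plus_sqr x y :
  norm (plus x y) ^ 2 = norm x ^ 2 + 2 * rin x y + norm y ^ 2.
Proof.
  rewrite <- !rin_norm, inner_plus_l, !inner_plus_r.
  simpl. change (fst (inner y x)) with (rin y x). rewrite (rin_sym y x).
  unfold Re; ring.
Qed.

Lemma norm_minus_sqr x y :
  norm (minus x y) ^ 2 = norm x ^ 2 - 2 * rin x y + norm y ^ 2.
Proof.
  unfold minus; rewrite norm_plus_sqr, norm_oppH, inner_opp_r.
  simpl; unfold Re; ring.
Qed.

Lemma norm_scal_sqr (k : C) x : norm (scal k x) ^ 2 = Cmod k ^ 2 * norm x ^ 2.
Proof.
  rewrite <- !rin_norm, inner_scal_l, inner_scal_r, inner_norm.
  unfold Cmod. rewrite pow2_sqrt by nra. simpl. ring.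
Qed.

Lemma rin_le x y : rin x y <= norm x * norm y.
Proof.
  pose proof (norm_triangleH x y) as Ht.
  pose proof (norm_plus_sqr x y) as Hs.
  pose proof (norm_geH (plus x y)). pose proof (norm_geH x).
  pose proof (norm_geH y). nra.
Qed.

Lemma inner_ext x y : (forall z, inner z x = inner z y) -> x = y.
Proof.
  intros E.
  assert (E2 : norm (minus y x) ^ 2 = 0).
  { rewrite <- rin_norm, inner_minus_r, E. simpl. ring. }
  assert (E3 : norm (minus y x) = 0) by nra.
  apply eq_close; intros eps. apply norm_compat1H.
  exact (eq_ind_r (fun r => r < eps) (cond_pos eps) E3).
Qed.

Lemma riesz (f : H -> C)
  (fD : forall x y, f (plus x y) = (f x + f y)%C)
  (fZ : forall (k : C) x, f (scal k x) = (k * f x)%C)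
  (fB : exists M, 0 < M /\ forall x, Cmod (f x) <= M * norm x) :
  exists u, forall x, f x = inner x u.
Proof.
  destruct fB as [M [M0 fB]].
  assert (fR : forall x, Rabs (Re (f x)) <= M * norm x).
  { intros x. eapply Rle_trans; [|apply fB].
    eapply Rle_trans; [|apply Rmax_Cmod]. apply Rmax_l. }
  assert (fO : forall x, f (opp x) = (- f x)%C).
  { intros x. rewrite opp_scal, fZ.
    apply injective_projections; simpl; ring. }
  pose (J := fun x => norm x ^ 2 - 2 * Re (f x)).
  assert (Jlb : forall x, - M ^ 2 <= J x).
  { intros x. unfold J. specialize (fR x). apply Rabs_le_between in fR.
    pose proof (Rle_0_sqr (norm x - M)). unfold Rsqr in *. nra. }
  destruct (completeness (fun r => exists x, r = - J x)) as [s [sub slub]].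
  { exists (M ^ 2). intros r [x ->]. specialize (Jlb x). lra. }
  { exists (- J zero). now exists zero. }
  pose (m := - s).
  assert (mlb : forall x, m <= J x).
  { intros x. unfold m. specialize (sub (- J x)). 
    assert (- J x <= s) by (apply sub; now exists x). lra. }
  assert (minf : forall eps, 0 < eps -> exists x, J x < m + eps).
  { intros eps He. apply NNPP. intros Hn.
    assert (s <= s - eps); [|lra]. apply slub. intros r [x ->].
    apply Rnot_lt_le. intros Hl. apply Hn. exists x. unfold m. lra. }
  assert (Jpar : forall x y eps, J x < m + eps -> J y < m + eps ->
            norm (minus x y) ^ 2 <= 4 * eps).
  { intros x y eps Hx Hy.
    pose proof (mlb (scal (RtoC (/ 2)) (plus x y))) as Hm.
    unfold J in *. rewrite norm_scal_sqr, fZ, fD, norm_plus_sqr in Hm.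
    rewrite Cmod_R, Rabs_pos_eq in Hm by lra.
    rewrite norm_minus_sqr. simpl in *. unfold Re in *. lra. }
  pose (F := fun P : H -> Prop =>
    exists eps : posreal, forall x, J x < m + eps -> P x).
  assert (PF : ProperFilter F).
  { split.
    - intros P [eps HP]. destruct (minf eps (cond_pos eps)) as [x Hx].
      exists x. auto.
    - split.
      + exists (mkposreal 1 Rlt_0_1). auto.
      + intros P Q [e1 H1] [e2 H2].
        exists (mkposreal _ (Rmin_stable_in_posreal e1 e2)). simpl.
        intros x Hx. pose proof (Rmin_l e1 e2). pose proof (Rmin_r e1 e2).
        split; [apply H1|apply H2]; lra.
      + intros P Q PQ [e HP]. exists e. auto. }
  assert (CF : cauchy F).
  { intros eps. pose proof (cond_pos eps) as He.
    assert (He' : 0 < eps ^ 2 / 8) by (apply Rdiv_lt_0_compat; nra).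
    destruct (minf _ He') as [x Hx]. exists x.
    exists (mkposreal _ He'). simpl. intros y Hy. apply norm_compat1H.
    pose proof (Jpar y x _ Hy Hx). pose proof (norm_geH (minus y x)). nra. }
  pose (u := lim F : H).
  assert (Hu : forall e, 0 < e -> exists x, J x < m + e /\ norm (minus u x) < e).
  { intros e He.
    pose proof (@norm_factor_gt_0 _ (hilbert_space H)) as Hnf.
    assert (He' : 0 < e / @norm_factor _ (hilbert_space H))
      by now apply Rdiv_lt_0_compat.
    destruct (complete_cauchy F PF CF (mkposreal _ He')) as [d Hd].
    destruct (minf (Rmin e d)) as [x Hx].
    { apply Rmin_pos; [assumption|apply cond_pos]. }
    exists x. pose proof (Rmin_l e d). pose proof (Rmin_r e d).
    split; [lra|].
    rewrite <- norm_oppH, opp_minus.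
    assert (Hb : ball u (mkposreal _ He') x) by (apply Hd; lra).
    apply norm_compat2H in Hb. simpl in Hb.
    replace (norm_factor * (e / norm_factor)) with e in Hb by (field; lra).
    exact Hb. }
  assert (Ju : J u <= m).
  { apply Rnot_lt_le. intros Hl.
    pose (K := 2 + 2 * norm u + 2 * M).
    pose proof (norm_geH u) as Hu0.
    assert (K0 : 0 < K) by (unfold K; lra).
    set (e := Rmin 1 ((J u - m) / K)).
    assert (e0 : 0 < e).
    { apply Rmin_pos; [lra|apply Rdiv_lt_0_compat; lra]. }
    assert (e1 : e <= 1) by apply Rmin_l.
    assert (eK : e * K <= J u - m).
    { replace (J u - m) with ((J u - m) / K * K) by (field; lra).
      apply Rmult_le_compat_r; [lra|apply Rmin_r]. }
    destruct (Hu e e0) as [x [Hx Hn]].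
    set (d := minus u x) in *.
    assert (Ex : x = minus u d).
    { apply inner_ext. intros z. unfold d. rewrite !inner_minus_r. ring. }
    assert (Jx : J x = J u - 2 * rin u d + norm d ^ 2 + 2 * Re (f d)).
    { unfold J. rewrite Ex at 1 2. rewrite norm_minus_sqr.
      unfold minus. rewrite fD, fO. simpl. unfold Re. ring. }
    pose proof (rin_le u d) as H1. pose proof (norm_geH d) as H2.
    pose proof (fR d) as H3. apply Rabs_le_between in H3.
    unfold K in eK. nra. }
  assert (Hre : forall v, Re (f v) = rin v u).
  { assert (Hle : forall v, Re (f v) <= rin v u).
    { intros v. apply Rnot_lt_le. intros Hl.
      set (c := Re (f v) - rin v u).
      assert (c0 : 0 < c) by (unfold c; lra).
      pose proof (pow2_ge_0 (norm v)) as Hv.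
      set (t := c / (norm v ^ 2 + 1)).
      assert (t0 : 0 < t) by (apply Rdiv_lt_0_compat; lra).
      assert (tc : t * (norm v ^ 2 + 1) = c) by (unfold t; field; lra).
      pose proof (mlb (plus u (scal (RtoC t) v))) as Hm.
      unfold J in Hm, Ju. rewrite norm_plus_sqr, norm_scal_sqr, fD, fZ in Hm.
      rewrite inner_scal_r, Cmod_R, Rabs_pos_eq in Hm by lra.
      assert (E1 : Re (Cconj (RtoC t) * inner u v)%C = t * rin v u).
      { rewrite (rin_sym v u). simpl. unfold Re. ring. }
      assert (E2 : Re (f u + RtoC t * f v)%C = Re (f u) + t * Re (f v)).
      { simpl. unfold Re. ring. }
      rewrite E1, E2 in Hm.
      assert (Hq : 0 <= t * (t * norm v ^ 2 - 2 * c)) by (unfold c; nra).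
      assert (t * norm v ^ 2 - 2 * c < 0) by nra. nra. }
    intros v. apply Rle_antisym; [apply Hle|].
    pose proof (Hle (opp v)) as Ho. rewrite fO, inner_opp_l in Ho.
    simpl in Ho. unfold Re in *. lra. }
  exists u. intros v. apply injective_projections; [apply Hre|].
  pose proof (Hre (scal Ci v)) as Hi. rewrite fZ, inner_scal_l in Hi.
  simpl in Hi. lra.
Qed.

Lemma adjoint_ex T :
  exists S : BOp H, forall x y, inner (T x) y = inner x (S y).
Proof.
  destruct (linear_norm _ (op_linear T)) as [M [M0 HM]].
  assert (CS : forall x y, Cmod (inner x y) <= norm x * norm y).
  { intros x y. set (w := inner x y).
    pose proof (rin_le (scal (Cconj w) x) y) as Hr.
    rewrite inner_scal_l in Hr. fold w in Hr.
    pose proof (norm_scal_sqr (Cconj w) x) as Hs. rewrite Cmod_conj in Hs.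
    assert (E : norm (scal (Cconj w) x) = Cmod w * norm x).
    { pose proof (norm_geH (scal (Cconj w) x)).
      pose proof (norm_geH x). pose proof (Cmod_ge_0 w).
      assert (0 <= Cmod w * norm x) by nra. nra. }
    rewrite E in Hr.
    assert (E2 : Re (Cconj w * w)%C = Cmod w ^ 2).
    { unfold Cmod. rewrite pow2_sqrt by nra. simpl. ring. }
    rewrite E2 in Hr.
    pose proof (Cmod_ge_0 w). pose proof (norm_geH x).
    pose proof (norm_geH y). 
    destruct (Req_dec (Cmod w) 0) as [->|Hw]; nra. }
  assert (HR : forall y, exists u, forall x, inner (T x) y = inner x u).
  { intros y. apply (riesz (fun x => inner (T x) y)).
    - intros x x'. now rewrite (linear_plus _ (op_linear T)), inner_plus_l.
    - intros k x. now rewrite (linear_scal _ (op_linear T)), inner_scal_l.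
    - pose proof (norm_geH y). exists (M * norm y + 1). split; [nra|].
      intros x. eapply Rle_trans; [apply CS|]. specialize (HM x).
      pose proof (norm_geH x). nra. }
  pose (S := fun y => proj1_sig (constructive_indefinite_description _ (HR y))).
  assert (HS : forall x y, inner (T x) y = inner x (S y)).
  { intros x y. unfold S.
    destruct (constructive_indefinite_description _ (HR y)) as [u Hu].
    apply Hu. }
  assert (SL : is_linear S).
  { split.
    - intros x y. apply inner_ext. intros z.
      now rewrite <- HS, !inner_plus_r, !HS.
    - intros k x. apply inner_ext. intros z.
      now rewrite <- HS, !inner_scal_r, HS.
    - exists M. split; [assumption|]. intros y.
      pose proof (HS (S y) y) as E. rewrite inner_norm in E.
      pose proof (rin_le (T (S y)) y) as Hr. rewrite E in Hr. simpl in Hr.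
      pose proof (HM (S y)). pose proof (norm_geH (S y)).
      pose proof (norm_geH y).
      destruct (Req_dec (norm (S y)) 0) as [->|Hn]; nra. }
  exists (Build_BOp H S SL). exact HS.
Qed.

Definition adjoint T : BOp H :=
  proj1_sig (constructive_indefinite_description _ (adjoint_ex T)).

Lemma adjoint_correct T x y : inner (T x) y = inner x (adjoint T y).
Proof.
  unfold adjoint.
  destruct (constructive_indefinite_description _ (adjoint_ex T)) as [S HS].
  apply HS.
Qed.

Lemma im_op_linear T :
  is_linear (fun x => scal (/ (2 * Ci))%C (minus (T x) (adjoint T x))).
Proof.
  apply (is_linear_comp (fun x => minus (T x) (adjoint T x))
                        (scal (/ (2 * Ci))%C)).
  - destruct (op_linear T) as [aT sT [M [M0 HM]]].
    destruct (op_linear (adjoint T)) as [aS sS [N [N0 HN]]].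
    split.
    + intros x y. rewrite aT, aS. apply inner_ext. intros z.
      rewrite inner_plus_r, !inner_minus_r, !inner_plus_r. ring.
    + intros k x. rewrite sT, sS. apply inner_ext. intros z.
      rewrite inner_scal_r, !inner_minus_r, !inner_scal_r. ring.
    + exists (M + N). split; [lra|]. intros x.
      eapply Rle_trans; [apply norm_triangle_minusH|].
      specialize (HM x). specialize (HN x). lra.
  - exact (is_linear_scal_r (V := hilbert_space H) (/ (2 * Ci))%C Cmult_comm).
Qed.

Definition im_op T : BOp H := Build_BOp H _ (im_op_linear T).

Definition op_nonneg T : Prop :=
  forall x, Im (inner (T x) x) = 0 /\ 0 <= Re (inner (T x) x).

Definition op_nonpos T : Prop :=
  forall x, Im (inner (T x) x) = 0 /\ Re (inner (T x) x) <= 0.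

Definition dissipative T : Prop := op_nonneg (im_op T).

Definition accumulative T : Prop := op_nonpos (im_op T).

(** The inequality says that the operator norm of
    [F w - F z - (w - z) D] is at most [eps * Cmod (w - z)]. *)
Definition op_derivable (F : C -> BOp H) (z : C) : Prop :=
  exists D : BOp H, forall eps : posreal, exists delta : posreal,
    forall w : C, Cmod (w - z) < delta -> forall x : H,
      norm (minus (minus (F w x) (F z x)) (scal (w - z)%C (D x)))
        <= eps * Cmod (w - z) * norm x.

(** A function on [C \ R] is represented by a total function whose values at
    real points are never used: [C \ R] is open, so [op_derivable F z] only
    depends on [F] near the non-real point [z]. *)
Record class_R (F : C -> BOp H) : Prop := {
  class_R_holomorphic : forall z : C, Im z <> 0 -> op_derivable F z;
  class_R_dissipative : forall z : C, 0 < Im z -> dissipative (F z);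
  class_R_accumulative : forall z : C, Im z < 0 -> accumulative (F z);
  class_R_adjoint : forall z : C, Im z <> 0 ->
    forall x, adjoint (F z) x = F (Cconj z) x
}.

Definition op_shift T (lambda : C) x : H := minus (T x) (scal lambda x).

Definition point_spectrum T (lambda : C) : Prop :=
  exists x, x <> zero /\ T x = scal lambda x.

Definition continuous_spectrum T (lambda : C) : Prop :=
  (forall x, op_shift T lambda x = zero -> x = zero) /\
  (forall y (eps : posreal), exists x, norm (minus (op_shift T lambda x) y) < eps) /\
  (exists y, forall x, op_shift T lambda x <> y).

Definition resolvent_set T (lambda : C) : Prop :=
  exists S : BOp H,
    (forall x, S (op_shift T lambda x) = x) /\
    (forall y, op_shift T lambda (S y) = y).

End Operators.

Arguments class_R {_} _.

(* Main.v *)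
Require Import Defs.
From Stdlib Require Import Reals Lra Lia Classical IndefiniteDescription.
From Coquelicot Require Import Coquelicot.

Open Scope R_scope.

(** The proof rests on one inequality of Harnack type for Nevanlinna functions
    (holomorphic functions on the upper half-plane with nonnegative imaginary
    part): for z and w in the upper half-plane there is a constant K, the same
    for all such f, with [Cmod (f z - f w) <= K * Im (f w)]
    ([nevanlinna_harnack]).

    It is applied to [f z = inner (F z u) u], where dissipativity is exactly
    the sign condition, with a constant that does not depend on u.
    Polarization then turns a bound on quadratic forms into a bound on
    vectors: [norm (F z x - F w x) ^ 2 <= K * Im (inner (F w x) x)]
    ([numerical_domination]).  For real a, subtracting a from F changes
    neither side, and the right side is at most
    [K * norm (F w x - a x) * norm x].  Hence [F z - a] is dominated by
    [F w - a] in the sense of [dominated], and likewise for the imaginary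
    parts.  Domination carries injectivity and boundedness below from the
    dominated operator to the dominating one, so both properties are the
    same at all points of the upper half-plane.

    These two properties determine the type of a real point a for a dissipative
    operator T.  The imaginary part of [inner (T x - a x) x] controls the
    difference between [T - a] and its adjoint, so these two operators dominate
    each other; an injective [T - a] therefore has dense range, and it is onto
    exactly when it is bounded below.  Thus a is an eigenvalue iff
    [T - a] is not injective, in the resolvent set iff [T - a] is bounded below,
    and in the continuous spectrum iff [T - a] is injective but not bounded
    below.  That surjectivity implies boundedness below is the bounded inverse
    theorem; it follows from a gliding hump construction ([gliding_hump]).

    The scalar inequality comes from a derivative bound:
    [Cmod (f' w) <= 4 / Im w * Im (f w)], which Gronwall's lemma integrates along
    the segment from w to z.  The derivative bound expresses that
    [Im g 0 + Im (g' 0) / 2] is the mean over the unit circle of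
    [Im g * (1 + cos t)], which is nonnegative when Im g is.  Here g is only
    assumed complex differentiable at each point, so the mean value formula is
    drawn from Goursat's bisection argument ([divergence_free_flux]), in the
    coordinates log of the modulus and argument. *)

(** * Divergence-free fields have zero flux through rectangles *)

Lemma nested_intervals (u : nat -> R) (L : R) : 0 <= L ->
  (forall n, u (S n) = u n \/ u (S n) = u n + L / 2 ^ S n) ->
  exists x, forall n, u n <= x <= u n + L / 2 ^ n.
Proof.
  intros L0 Hu.
  assert (Hp : forall n, 0 <= L / 2 ^ n).
  { intros n. apply Rdiv_le_0_compat; [lra|apply pow_lt; lra]. }
  assert (Hs : forall n, L / 2 ^ S n + L / 2 ^ S n = L / 2 ^ n).
  { intros n. simpl. field. apply pow_nonzero. lra. }
  assert (U1 : forall n, u n <= u (S n)).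
  { intros n. specialize (Hp (S n)). destruct (Hu n); lra. }
  assert (U2 : forall n, u (S n) + L / 2 ^ S n <= u n + L / 2 ^ n).
  { intros n. specialize (Hp (S n)). specialize (Hs n). destruct (Hu n); lra. }
  assert (U3 : forall n k, u n <= u (n + k)%nat /\
             u (n + k)%nat + L / 2 ^ (n + k) <= u n + L / 2 ^ n).
  { intros n k. induction k as [|k IH].
    - rewrite Nat.add_0_r. lra.
    - rewrite Nat.add_succ_r. specialize (U1 (n + k)%nat).
      specialize (U2 (n + k)%nat). lra. }
  assert (U4 : forall n m, u m <= u n + L / 2 ^ n).
  { intros n m. destruct (U3 n m) as [_ H1]. destruct (U3 m n) as [H2 _].
    rewrite (Nat.add_comm m n) in H2. specialize (Hp (n + m)%nat). lra. }
  destruct (ex_finite_lim_seq_incr u _ U1 (U4 0%nat)) as [x Hx].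
  exists x. intros n. split.
  - exact (is_lim_seq_incr_compare u x Hx U1 n).
  - exact (is_lim_seq_le u (fun _ => u n + L / 2 ^ n) x (u n + L / 2 ^ n)
             (U4 n) Hx (is_lim_seq_const _)).
Qed.

Lemma nested_rectangles (B : nat -> R -> R -> Prop) (a c L M : R) :
  0 <= L -> 0 <= M -> B 0%nat a c ->
  (forall n x y, B n x y -> exists x' y', B (S n) x' y' /\
     (x' = x \/ x' = x + L / 2 ^ S n) /\ (y' = y \/ y' = y + M / 2 ^ S n)) ->
  exists x0 y0, forall n, exists x y, B n x y /\
     x <= x0 <= x + L / 2 ^ n /\ y <= y0 <= y + M / 2 ^ n.
Proof.
  intros L0 M0 B0 step.
  assert (step' : forall n (p : R * R), exists q : R * R,
    B n (fst p) (snd p) -> B (S n) (fst q) (snd q) /\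
     (fst q = fst p \/ fst q = fst p + L / 2 ^ S n) /\
     (snd q = snd p \/ snd q = snd p + M / 2 ^ S n)).
  { intros n [x y]. destruct (classic (B n x y)) as [Hb|Hb].
    - destruct (step n x y Hb) as [x' [y' Hq]]. exists (x', y'). auto.
    - exists (0, 0). intros Hb'. now destruct Hb. }
  pose proof (fun n => functional_choice _ (step' n)) as step2.
  apply functional_choice in step2. destruct step2 as [nxt Hnxt].
  pose (w := nat_rect (fun _ => (R * R)%type) (a, c) nxt).
  assert (Hw : forall n, B n (fst (w n)) (snd (w n)) ->
     B (S n) (fst (w (S n))) (snd (w (S n))) /\
     (fst (w (S n)) = fst (w n) \/ fst (w (S n)) = fst (w n) + L / 2 ^ S n) /\
     (snd (w (S n)) = snd (w n) \/ snd (w (S n)) = snd (w n) + M / 2 ^ S n)).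
  { intros n. exact (Hnxt n (w n)). }
  assert (HB : forall n, B n (fst (w n)) (snd (w n))).
  { induction n as [|n IH]; [exact B0|]. now apply Hw. }
  destruct (nested_intervals (fun n => fst (w n)) L L0) as [x0 Hx].
  { intros n. now apply Hw. }
  destruct (nested_intervals (fun n => snd (w n)) M M0) as [y0 Hy].
  { intros n. now apply Hw. }
  exists x0, y0. intros n. exists (fst (w n)), (snd (w n)). auto.
Qed.

(** The outward flux of the field (Q, P) through the boundary of
    [a, b] x [c, d].  For P = Re f and Q = Im f it is, up to sign, the real part
    of the contour integral of f. *)
Definition flux (P Q : R -> R -> R) (a b c d : R) : R :=
  RInt (fun x => P x d - P x c) a b + RInt (fun y => Q b y - Q a y) c d.

(** What is needed for the integrals in [flux] to exist on every
    subrectangle. *)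
Definition sliceable (P Q : R -> R -> R) (a b c d : R) : Prop :=
  (forall y, c <= y <= d -> ex_RInt (fun x => P x y) a b) /\
  (forall x, a <= x <= b -> ex_RInt (fun y => Q x y) c d).

(** Exchanging the coordinates reduces horizontal cuts to vertical ones. *)
Lemma flux_transpose P Q a b c d :
  flux P Q a b c d = flux (fun y x => Q x y) (fun y x => P x y) c d a b.
Proof. unfold flux. ring. Qed.

Lemma sliceable_sub P Q a b c d a' b' c' d' :
  a <= a' -> a' <= b' -> b' <= b -> c <= c' -> c' <= d' -> d' <= d ->
  sliceable P Q a b c d -> sliceable P Q a' b' c' d'.
Proof.
  intros ? ? ? ? ? ? [HP HQ]. split.
  - intros y Hy. apply (ex_RInt_Chasles_2 (V := R_CompleteNormedModule)) with a.
    + lra.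
    + apply (ex_RInt_Chasles_1 (V := R_CompleteNormedModule)) with b; [lra|].
      apply HP. lra.
  - intros x Hx. apply (ex_RInt_Chasles_2 (V := R_CompleteNormedModule)) with c.
    + lra.
    + apply (ex_RInt_Chasles_1 (V := R_CompleteNormedModule)) with d; [lra|].
      apply HQ. lra.
Qed.

Lemma flux_split P Q a m b c d : a <= m -> m <= b -> c <= d ->
  sliceable P Q a b c d ->
  flux P Q a b c d = flux P Q a m c d + flux P Q m b c d.
Proof.
  intros Ha Hb Hc HS.
  destruct (sliceable_sub _ _ _ _ _ _ a m c d (Rle_refl _) Ha Hb
              (Rle_refl _) Hc (Rle_refl _) HS) as [P1 Q1].
  destruct (sliceable_sub _ _ _ _ _ _ m b c d Ha Hb (Rle_refl _)
              (Rle_refl _) Hc (Rle_refl _) HS) as [P2 Q2].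
  unfold flux.
  rewrite <- (RInt_Chasles (fun x => P x d - P x c) a m b).
  - rewrite (RInt_minus (V := R_CompleteNormedModule)
               (fun y => Q b y) (fun y => Q a y)).
    rewrite (RInt_minus (V := R_CompleteNormedModule)
               (fun y => Q m y) (fun y => Q a y)).
    rewrite (RInt_minus (V := R_CompleteNormedModule)
               (fun y => Q b y) (fun y => Q m y)).
    + unfold minus, plus, opp; simpl. ring.
    + apply Q2; lra.
    + apply Q1; lra.
    + apply Q1; lra.
    + apply Q1; lra.
    + apply Q2; lra.
    + apply Q1; lra.
  - apply (ex_RInt_minus (V := R_CompleteNormedModule)
             (fun x => P x d) (fun x => P x c)); apply P1; lra.
  - apply (ex_RInt_minus (V := R_CompleteNormedModule)
             (fun x => P x d) (fun x => P x c)); apply P2; lra.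
Qed.

Lemma sliceable_transpose P Q a b c d : sliceable P Q a b c d ->
  sliceable (fun y x => Q x y) (fun y x => P x y) c d a b.
Proof. now intros [HP HQ]; split. Qed.

Lemma flux_quadrisect P Q x y l m : 0 <= l -> 0 <= m ->
  sliceable P Q x (x + 2 * l) y (y + 2 * m) ->
  flux P Q x (x + 2 * l) y (y + 2 * m) =
    flux P Q x (x + l) y (y + m)
    + flux P Q x (x + l) (y + m) (y + m + m)
    + flux P Q (x + l) (x + l + l) y (y + m)
    + flux P Q (x + l) (x + l + l) (y + m) (y + m + m).
Proof.
  intros Hl Hm HS.
  replace (x + 2 * l) with (x + l + l) in * by ring.
  replace (y + 2 * m) with (y + m + m) in * by ring.
  rewrite (flux_split P Q x (x + l)) by (assumption || lra).
  assert (V : forall a b, x <= a -> a <= b -> b <= x + l + l ->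
    flux P Q a b y (y + m + m) =
    flux P Q a b y (y + m) + flux P Q a b (y + m) (y + m + m)).
  { intros a b Hxa Hab Hb. rewrite !(flux_transpose P Q).
    apply flux_split; try lra. apply sliceable_transpose.
    eapply sliceable_sub; [..|exact HS]; lra. }
  rewrite !V by lra. ring.
Qed.

Definition divergence_free_at (P Q : R -> R -> R) (x y : R) : Prop :=
  exists px py qx qy, differentiable_pt_lim P x y px py /\
    differentiable_pt_lim Q x y qx qy /\ py + qx = 0.

Lemma differentiable_pt_lim_ball P x y px py eps :
  differentiable_pt_lim P x y px py -> 0 < eps ->
  exists delta, 0 < delta /\ forall u v, Rabs (u - x) < delta ->
    Rabs (v - y) < delta ->
    Rabs (P u v - P x y - (px * (u - x) + py * (v - y)))
      <= eps * (Rabs (u - x) + Rabs (v - y)).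
Proof.
  intros D He. destruct (D (mkposreal eps He)) as [delta Hd].
  exists delta. split; [apply cond_pos|]. intros u v Hu Hv.
  eapply Rle_trans; [exact (Hd u v Hu Hv)|]. simpl.
  apply Rmult_le_compat_l; [lra|].
  pose proof (Rabs_pos (u - x)). pose proof (Rabs_pos (v - y)).
  apply Rmax_lub; lra.
Qed.

Lemma RInt_near_const f a b k e : a <= b -> ex_RInt f a b ->
  (forall x, a <= x <= b -> Rabs (f x - k) <= e) ->
  Rabs (RInt f a b - k * (b - a)) <= (b - a) * e.
Proof.
  intros Hab Hf He.
  replace (RInt f a b - k * (b - a)) with (RInt (fun x => f x - k) a b).
  - apply abs_RInt_le_const; [assumption| |assumption].
    apply (ex_RInt_minus (V := R_CompleteNormedModule)); [assumption|].
    apply ex_RInt_const.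
  - rewrite (RInt_minus (V := R_CompleteNormedModule) f (fun _ => k));
      [|assumption|apply ex_RInt_const].
    rewrite RInt_const. unfold minus, plus, opp, scal; simpl.
    unfold mult; simpl. ring.
Qed.

(** The affine part of the field at the point contributes its divergence times
    the area, that is 0; only the first order remainder is left.  For rectangles
    of a fixed shape the bound is o(area), which beats the loss of a factor 4
    at each quadrisection. *)
Lemma divergence_free_flux_small P Q x0 y0 eps : 0 < eps ->
  divergence_free_at P Q x0 y0 ->
  exists delta, 0 < delta /\ forall x y l m, 0 <= l -> 0 <= m ->
    l < delta -> m < delta ->
    x <= x0 <= x + l -> y <= y0 <= y + m ->
    sliceable P Q x (x + l) y (y + m) ->
    Rabs (flux P Q x (x + l) y (y + m)) <= eps * (l + m) ^ 2.
Proof.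
  intros He [px [py [qx [qy [DP [DQ E]]]]]].
  assert (He2 : 0 < eps / 2) by lra.
  destruct (differentiable_pt_lim_ball _ _ _ _ _ _ DP He2) as [d1 [d10 H1]].
  destruct (differentiable_pt_lim_ball _ _ _ _ _ _ DQ He2) as [d2 [d20 H2]].
  exists (Rmin d1 d2). split; [now apply Rmin_pos|].
  intros x y l m Hl Hm Hld Hmd Hx Hy [SP SQ].
  pose proof (Rmin_l d1 d2). pose proof (Rmin_r d1 d2).
  assert (B1 : forall u, x <= u <= x + l -> Rabs (u - x0) <= l)
    by (intros u Hu; apply Rabs_le; lra).
  assert (B2 : forall v, y <= v <= y + m -> Rabs (v - y0) <= m)
    by (intros v Hv; apply Rabs_le; lra).
  assert (EP : forall u v, x <= u <= x + l -> y <= v <= y + m ->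
     Rabs (P u v - P x0 y0 - (px * (u - x0) + py * (v - y0))) <= eps / 2 * (l + m)).
  { intros u v Hu Hv. specialize (B1 u Hu). specialize (B2 v Hv).
    eapply Rle_trans; [apply H1; lra|]. apply Rmult_le_compat_l; lra. }
  assert (EQ : forall u v, x <= u <= x + l -> y <= v <= y + m ->
     Rabs (Q u v - Q x0 y0 - (qx * (u - x0) + qy * (v - y0))) <= eps / 2 * (l + m)).
  { intros u v Hu Hv. specialize (B1 u Hu). specialize (B2 v Hv).
    eapply Rle_trans; [apply H2; lra|]. apply Rmult_le_compat_l; lra. }
  unfold flux.
  pose proof (RInt_near_const (fun u => P u (y + m) - P u y) x (x + l)
    (py * m) (eps * (l + m))) as I1.
  pose proof (RInt_near_const (fun v => Q (x + l) v - Q x v) y (y + m)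
    (qx * l) (eps * (l + m))) as I2.
  assert (J1 := I1 ltac:(lra)
    (ex_RInt_minus (V := R_CompleteNormedModule) (fun u => P u (y + m))
       (fun u => P u y) _ _ (SP (y + m) ltac:(lra)) (SP y ltac:(lra)))). clear I1.
  assert (J2 := I2 ltac:(lra)
    (ex_RInt_minus (V := R_CompleteNormedModule) (fun v => Q (x + l) v)
       (fun v => Q x v) _ _ (SQ (x + l) ltac:(lra)) (SQ x ltac:(lra)))). clear I2.
  assert (K1 : forall u, x <= u <= x + l ->
     Rabs (P u (y + m) - P u y - py * m) <= eps * (l + m)).
  { intros u Hu. pose proof (EP u (y + m) Hu ltac:(lra)) as A1.
    pose proof (EP u y Hu ltac:(lra)) as A2.
    apply Rabs_le_between in A1. apply Rabs_le_between in A2.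
    apply Rabs_le. lra. }
  assert (K2 : forall v, y <= v <= y + m ->
     Rabs (Q (x + l) v - Q x v - qx * l) <= eps * (l + m)).
  { intros v Hv. pose proof (EQ (x + l) v ltac:(lra) Hv) as A1.
    pose proof (EQ x v ltac:(lra) Hv) as A2.
    apply Rabs_le_between in A1. apply Rabs_le_between in A2.
    apply Rabs_le. lra. }
  specialize (J1 K1). specialize (J2 K2).
  apply Rabs_le_between in J1. apply Rabs_le_between in J2.
  assert (Z : py * m * (x + l - x) + qx * l * (y + m - y) = 0).
  { replace qx with (- py) by lra. ring. }
  replace (eps * (l + m) ^ 2)
    with ((x + l - x) * (eps * (l + m)) + (y + m - y) * (eps * (l + m))) by ring.
  apply Rabs_le. lra.
Qed.

Lemma differentiable_slices P Q a b c d :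
  (forall x y, a <= x <= b -> c <= y <= d -> divergence_free_at P Q x y) ->
  a <= b -> c <= d -> sliceable P Q a b c d.
Proof.
  intros D Hab Hcd. split.
  - intros y Hy. apply (ex_RInt_continuous (V := R_CompleteNormedModule)).
    rewrite Rmin_left, Rmax_right by assumption. intros x Hx.
    destruct (D x y Hx Hy) as [px [py [qx [qy [DP _]]]]].
    apply continuity_pt_filterlim, continuity_pt_locally. intros eps.
    destruct (differentiable_continuity_pt P x y
      (ex_intro _ px (ex_intro _ py DP)) eps) as [dl Hd].
    exists dl. intros u Hu. apply Hd; [exact Hu|].
    rewrite Rminus_diag, Rabs_R0. apply cond_pos.
  - intros x Hx. apply (ex_RInt_continuous (V := R_CompleteNormedModule)).
    rewrite Rmin_left, Rmax_right by assumption. intros y Hy.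
    destruct (D x y Hx Hy) as [px [py [qx [qy [_ [DQ _]]]]]].
    apply continuity_pt_filterlim, continuity_pt_locally. intros eps.
    destruct (differentiable_continuity_pt Q x y
      (ex_intro _ qx (ex_intro _ qy DQ)) eps) as [dl Hd].
    exists dl. intros v Hv. apply Hd; [|exact Hv].
    rewrite Rminus_diag, Rabs_R0. apply cond_pos.
Qed.

(** Goursat's argument: a nonzero flux would survive, up to the factor 1/4, in one
    of the four quarters at each step, and contradict
    [divergence_free_flux_small] at the limit point.  Since the partial
    derivatives may be discontinuous, integrating the divergence over the
    rectangle would not do. *)
Lemma divergence_free_flux P Q a b c d : a < b -> c < d ->
  (forall x y, a <= x <= b -> c <= y <= d -> divergence_free_at P Q x y) ->
  flux P Q a b c d = 0.
Proof.
  intros Hab Hcd D.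
  pose proof (differentiable_slices P Q a b c d D ltac:(lra) ltac:(lra)) as HS.
  apply NNPP. intros Hne.
  set (L := b - a). set (M := d - c).
  set (k := Rabs (flux P Q a b c d)).
  assert (k0 : 0 < k) by now apply Rabs_pos_lt.
  assert (L0 : 0 < L) by (unfold L; lra). assert (M0 : 0 < M) by (unfold M; lra).
  pose (B := fun (n : nat) x y => a <= x /\ x + L / 2 ^ n <= b /\
     c <= y /\ y + M / 2 ^ n <= d /\
     k / 4 ^ n <= Rabs (flux P Q x (x + L / 2 ^ n) y (y + M / 2 ^ n))).
  assert (P2 : forall n, 0 < 2 ^ n) by (intros; apply pow_lt; lra).
  assert (P4 : forall n, 0 < 4 ^ n) by (intros; apply pow_lt; lra).
  destruct (nested_rectangles B a c L M) as [x0 [y0 Hn]]; try lra.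
  { unfold B. simpl. unfold Rdiv. rewrite Rinv_1, !Rmult_1_r.
    replace (a + L) with b by (unfold L; ring).
    replace (c + M) with d by (unfold M; ring). fold k. lra. }
  { intros n x y [Ha [Hb [Hc [Hd Hk]]]].
    set (l := L / 2 ^ S n). set (m := M / 2 ^ S n).
    assert (El : L / 2 ^ n = 2 * l)
      by (unfold l; simpl; field; specialize (P2 n); lra).
    assert (Em : M / 2 ^ n = 2 * m)
      by (unfold m; simpl; field; specialize (P2 n); lra).
    assert (Ek : k / 4 ^ n = 4 * (k / 4 ^ S n))
      by (simpl; field; specialize (P4 n); lra).
    assert (l0 : 0 < l) by (apply Rdiv_lt_0_compat; auto).
    assert (m0 : 0 < m) by (apply Rdiv_lt_0_compat; auto).
    rewrite El, Em, Ek in *.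
    rewrite flux_quadrisect in Hk;
      [|lra|lra|eapply sliceable_sub; [..|exact HS]; lra].
    unfold B. fold l m.
    destruct (Rle_lt_dec (k / 4 ^ S n) (Rabs (flux P Q x (x + l) y (y + m)))) as [h1|h1].
    { exists x, y. repeat split; auto; lra. }
    destruct (Rle_lt_dec (k / 4 ^ S n)
      (Rabs (flux P Q x (x + l) (y + m) (y + m + m)))) as [h2|h2].
    { exists x, (y + m). repeat split; auto; lra. }
    destruct (Rle_lt_dec (k / 4 ^ S n)
      (Rabs (flux P Q (x + l) (x + l + l) y (y + m)))) as [h3|h3].
    { exists (x + l), y. repeat split; auto; lra. }
    destruct (Rle_lt_dec (k / 4 ^ S n)
      (Rabs (flux P Q (x + l) (x + l + l) (y + m) (y + m + m)))) as [h4|h4].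
    { exists (x + l), (y + m). repeat split; auto; lra. }
    exfalso. revert Hk. apply Rlt_not_le.
    apply Rabs_def2 in h1. apply Rabs_def2 in h2.
    apply Rabs_def2 in h3. apply Rabs_def2 in h4. apply Rabs_def1; lra. }
  assert (D0 : divergence_free_at P Q x0 y0).
  { destruct (Hn 0%nat) as [x [y [[Ha [Hb [Hc [Hd _]]]] [Hx Hy]]]].
    apply D; lra. }
  (* With this e the local bound at level n is half of k / 4 ^ n, for every n. *)
  set (e := k / (2 * (L + M) ^ 2)).
  assert (e0 : 0 < e) by (apply Rdiv_lt_0_compat; nra).
  destruct (divergence_free_flux_small P Q x0 y0 e e0 D0) as [dl [dl0 Hd]].
  destruct (pow_lt_1_zero (/ 2)
     ltac:(rewrite Rabs_pos_eq; lra) (dl / (L + M))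
     ltac:(apply Rdiv_lt_0_compat; lra)) as [n Hn2].
  specialize (Hn2 n (le_n n)).
  rewrite pow_inv, Rabs_inv, Rabs_pos_eq in Hn2 by (specialize (P2 n); lra).
  assert (Hs : (L + M) / 2 ^ n < dl).
  { apply Rmult_lt_reg_r with (/ (L + M)); [apply Rinv_0_lt_compat; lra|].
    replace ((L + M) / 2 ^ n * / (L + M)) with (/ 2 ^ n); [exact Hn2|].
    field. specialize (P2 n). lra. }
  destruct (Hn n) as [x [y [[Ha [Hb [Hc [Hdd Hk]]]] [Hx Hy]]]].
  assert (l0 : 0 < L / 2 ^ n) by (apply Rdiv_lt_0_compat; auto).
  assert (m0 : 0 < M / 2 ^ n) by (apply Rdiv_lt_0_compat; auto).
  assert (Elm : (L + M) / 2 ^ n = L / 2 ^ n + M / 2 ^ n)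
    by (field; specialize (P2 n); lra).
  specialize (Hd x y (L / 2 ^ n) (M / 2 ^ n) ltac:(lra) ltac:(lra)
    ltac:(lra) ltac:(lra) Hx Hy).
  assert (Hfin := Hd ltac:(eapply sliceable_sub; [..|exact HS]; lra)).
  rewrite <- Elm in Hfin.
  assert (E44 : (2 ^ n) ^ 2 = 4 ^ n).
  { rewrite <- pow_mult, Nat.mul_comm, pow_mult. f_equal. lra. }
  assert (Ee : e * ((L + M) / 2 ^ n) ^ 2 = k / 4 ^ n / 2).
  { rewrite <- E44. unfold e. field. specialize (P2 n). split; lra. }
  rewrite Ee in Hfin.
  assert (0 < k / 4 ^ n) by (apply Rdiv_lt_0_compat; auto). lra.
Qed.

(** * Complex derivatives and the complex exponential *)

(** The codomain is C as a module over itself, so that the product and chain rules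
    for [is_derive] apply without change of structure. *)
Definition cderiv (f : C -> C) (z d : C) : Prop :=
  @is_derive C_AbsRing (AbsRing_NormedModule C_AbsRing) f z d.

Lemma cderivP f z d : cderiv f z d <->
  forall eps, 0 < eps -> exists delta, 0 < delta /\ forall w,
    Cmod (w - z) < delta ->
    Cmod (f w - f z - (w - z) * d)%C <= eps * Cmod (w - z).
Proof.
  split.
  - intros [_ D] eps He.
    destruct (D z (fun P HP => HP) (mkposreal eps He)) as [dl Hd].
    exists dl. split; [apply cond_pos|]. intros w Hw. exact (Hd w Hw).
  - intros D. split.
    + exact (is_linear_scal_l (V := AbsRing_NormedModule C_AbsRing) d).
    + intros x Hx eps.
      assert (Ex : z = x)
        by exact (is_filter_lim_locally_unique
                    (V := AbsRing_NormedModule C_AbsRing) z x Hx).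
      subst x.
      destruct (D eps (cond_pos eps)) as [dl [dl0 Hd]].
      exists (mkposreal dl dl0). intros w Hw. exact (Hd w Hw).
Qed.

Lemma cderiv_mult f g z df dg : cderiv f z df -> cderiv g z dg ->
  cderiv (fun w => f w * g w)%C z (df * g z + f z * dg)%C.
Proof.
  intros Hf Hg. exact (is_derive_mult f g z df dg Hf Hg Cmult_comm).
Qed.

Lemma cderiv_plus f g z df dg : cderiv f z df -> cderiv g z dg ->
  cderiv (fun w => f w + g w)%C z (df + dg)%C.
Proof. exact (is_derive_plus (V := AbsRing_NormedModule C_AbsRing) f g z df dg). Qed.

Lemma cderiv_const k z : cderiv (fun _ => k) z 0%C.
Proof. exact (is_derive_const (V := AbsRing_NormedModule C_AbsRing) k z). Qed.

Lemma cderiv_comp f g z df dg : cderiv f (g z) df -> cderiv g z dg ->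
  cderiv (fun w => f (g w)) z (dg * df)%C.
Proof. exact (is_derive_comp (V := AbsRing_NormedModule C_AbsRing) f g z df dg). Qed.

Lemma cderiv_affine (b k z : C) : cderiv (fun w => b + k * w)%C z k.
Proof.
  apply cderivP. intros eps He. exists 1. split; [lra|]. intros w _.
  replace (b + k * w - (b + k * z) - (w - z) * k)%C with (RtoC 0) by ring.
  rewrite Cmod_0. apply Rmult_le_pos; [lra|apply Cmod_ge_0].
Qed.

Lemma Im_le_Cmod (c : C) : Rabs (Im c) <= Cmod c.
Proof. eapply Rle_trans; [|apply Rmax_Cmod]. apply Rmax_r. Qed.

Lemma Cmod_le_abs (c : C) : Cmod c <= Rabs (Re c) + Rabs (Im c).
Proof.
  pose proof (Cmod2_alt c) as E. pose proof (Cmod_ge_0 c).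
  rewrite <- (pow2_abs (Re c)), <- (pow2_abs (Im c)) in E.
  pose proof (Rabs_pos (Re c)). pose proof (Rabs_pos (Im c)). nra.
Qed.

(** One of the two Cauchy-Riemann equations: the field (Im f, Re f) has divergence
    [Im f' - Im f' = 0]. *)
Lemma cderiv_divergence_free f x y d : cderiv f (x, y) d ->
  divergence_free_at (fun u v => Re (f (u, v))) (fun u v => Im (f (u, v))) x y.
Proof.
  intros Hf. rewrite cderivP in Hf.
  assert (Hl : forall eps : posreal, exists delta : posreal, forall u v,
    Rabs (u - x) < delta -> Rabs (v - y) < delta ->
    Cmod (f (u, v) - f (x, y) - ((u, v) - (x, y)) * d)%C
      <= eps * Rmax (Rabs (u - x)) (Rabs (v - y))).
  { intros eps. pose proof (cond_pos eps) as He.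
    destruct (Hf (eps / 2)) as [dl [dl0 Hd]]; [lra|].
    assert (dl2 : 0 < dl / 2) by lra.
    exists (mkposreal _ dl2). simpl. intros u v Hu Hv.
    assert (Hm : Cmod ((u, v) - (x, y))%C <= Rabs (u - x) + Rabs (v - y))
      by exact (Cmod_le_abs ((u, v) - (x, y))%C).
    eapply Rle_trans; [apply Hd; lra|].
    pose proof (Rmax_l (Rabs (u - x)) (Rabs (v - y))).
    pose proof (Rmax_r (Rabs (u - x)) (Rabs (v - y))). nra. }
  exists (Re d), (- Im d), (Im d), (Re d). repeat split; [| |ring].
  - intros eps. destruct (Hl eps) as [dl Hd]. exists dl. intros u v Hu Hv.
    eapply Rle_trans; [|apply (Hd u v Hu Hv)].
    eapply Rle_trans; [|apply re_le_Cmod]. apply Req_le. f_equal.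
    simpl. unfold Re, Im. ring.
  - intros eps. destruct (Hl eps) as [dl Hd]. exists dl. intros u v Hu Hv.
    eapply Rle_trans; [|apply (Hd u v Hu Hv)].
    eapply Rle_trans; [|apply Im_le_Cmod]. apply Req_le. f_equal.
    simpl. unfold Re, Im. ring.
Qed.

Definition cexp (z : C) : C := (exp (Re z) * cos (Im z), exp (Re z) * sin (Im z)).

Lemma cexp_plus z w : cexp (z + w)%C = (cexp z * cexp w)%C.
Proof.
  unfold cexp. simpl. rewrite exp_plus, cos_plus, sin_plus.
  apply injective_projections; simpl; unfold Re, Im; ring.
Qed.

Lemma Cmod_cexp z : Cmod (cexp z) = exp (Re z).
Proof.
  pose proof (Cmod2_alt (cexp z)) as E. unfold cexp in E at 2 3. simpl in E.
  pose proof (sin2_cos2 (Im z)) as S. unfold Rsqr in S.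
  pose proof (exp_pos (Re z)). pose proof (Cmod_ge_0 (cexp z)).
  assert (Cmod (cexp z) * Cmod (cexp z) = exp (Re z) * exp (Re z)) by nra. nra.
Qed.

Lemma real_deriv_small f x d eps : is_derive f x d -> 0 < eps ->
  exists delta, 0 < delta /\ forall h, Rabs h < delta ->
    Rabs (f (x + h) - f x - h * d) <= eps * Rabs h.
Proof.
  intros [_ D] He.
  destruct (D x (fun P HP => HP) (mkposreal eps He)) as [dl Hd].
  exists dl. split; [apply cond_pos|]. intros h Hh.
  specialize (Hd (x + h)).
  assert (Hb : ball x dl (x + h)).
  { unfold ball; simpl. unfold AbsRing_ball, abs, minus, plus, opp; simpl.
    now replace (x + h + - x) with h by ring. }
  specialize (Hd Hb). unfold norm, minus, plus, opp, scal in Hd; simpl in Hd.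
  unfold mult, abs in Hd; simpl in Hd.
  replace (x + h + - x) with h in Hd by ring. exact Hd.
Qed.

(** Obtained from the derivatives of exp, cos and sin at 0 through
    [exp s * cos t - 1 - s = (exp s - 1 - s) * cos t + (1 + s) * (cos t - 1)] and
    [exp s * sin t - t = (exp s - 1) * sin t + (sin t - t)]. *)
Lemma cderiv_cexp_0 : cderiv cexp 0%C 1%C.
Proof.
  apply cderivP. intros eps He.
  set (e := Rmin 1 (eps / 5)).
  assert (e0 : 0 < e) by (apply Rmin_pos; lra).
  assert (e1 : e <= 1) by apply Rmin_l.
  assert (e5 : 5 * e <= eps) by (assert (e <= eps / 5) by apply Rmin_r; lra).
  assert (Dexp : is_derive exp 0 1) by (auto_derive; [easy|rewrite exp_0; ring]).
  assert (Dcos : is_derive cos 0 0) by (auto_derive; [easy|rewrite sin_0; ring]).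
  assert (Dsin : is_derive sin 0 1) by (auto_derive; [easy|rewrite cos_0; ring]).
  destruct (real_deriv_small _ _ _ _ Dexp e0) as [d1 [d10 H1]].
  destruct (real_deriv_small _ _ _ _ Dcos e0) as [d2 [d20 H2]].
  destruct (real_deriv_small _ _ _ _ Dsin e0) as [d3 [d30 H3]].
  exists (Rmin (Rmin d1 d2) (Rmin d3 (e / 4))). split.
  { repeat apply Rmin_pos; lra. }
  intros w Hw. replace (w - 0)%C with w in * by ring.
  destruct w as [s t].
  pose proof (re_le_Cmod (s, t)) as Hs. pose proof (Im_le_Cmod (s, t)) as Ht.
  simpl in Hs, Ht.
  pose proof (Rmin_l (Rmin d1 d2) (Rmin d3 (e / 4))).
  pose proof (Rmin_r (Rmin d1 d2) (Rmin d3 (e / 4))).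
  pose proof (Rmin_l d1 d2). pose proof (Rmin_r d1 d2).
  pose proof (Rmin_l d3 (e / 4)). pose proof (Rmin_r d3 (e / 4)).
  set (m := Cmod (s, t)) in *.
  specialize (H1 s ltac:(lra)). specialize (H2 t ltac:(lra)).
  specialize (H3 t ltac:(lra)).
  rewrite Rplus_0_l in H1, H2, H3. rewrite exp_0 in H1. rewrite cos_0 in H2.
  rewrite sin_0 in H3.
  set (a := exp s - 1 - s * 1) in *. set (b := cos t - 1 - t * 0) in *.
  set (c := sin t - 0 - t * 1) in *.
  assert (Hx : (cexp (s, t) - cexp 0 - (s, t) * 1)%C
     = (a * cos t + (1 + s) * b, (s + a) * sin t + c)).
  { unfold cexp, a, b, c. apply injective_projections; simpl;
    rewrite ?exp_0, ?cos_0, ?sin_0; ring. }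
  rewrite Hx. eapply Rle_trans; [apply Cmod_le_abs|]. simpl.
  pose proof (COS_bound t). pose proof (SIN_bound t).
  assert (Hc1 : Rabs (cos t) <= 1) by (apply Rabs_le; lra).
  assert (Hb1 : Rabs (a * cos t) <= e * m).
  { rewrite Rabs_mult. pose proof (Rabs_pos a). pose proof (Rabs_pos (cos t)). nra. }
  assert (Hb2 : Rabs ((1 + s) * b) <= 2 * (e * m)).
  { rewrite Rabs_mult.
    assert (Rabs (1 + s) <= 2).
    { eapply Rle_trans; [apply Rabs_triang|]. rewrite Rabs_R1. lra. }
    pose proof (Rabs_pos b). pose proof (Rabs_pos (1 + s)). nra. }
  assert (Hst : Rabs (sin t) <= 2 * m).
  { replace (sin t) with (c + t) by (unfold c; ring).
    eapply Rle_trans; [apply Rabs_triang|]. pose proof (Rabs_pos t). nra. }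
  assert (Hsa : Rabs (s + a) <= e / 2).
  { eapply Rle_trans; [apply Rabs_triang|]. 
    assert (Rabs a <= Rabs s) by (pose proof (Rabs_pos s); nra).
    lra. }
  assert (Hb3 : Rabs ((s + a) * sin t) <= e * m).
  { rewrite Rabs_mult. pose proof (Rabs_pos (s + a)).
    pose proof (Rabs_pos (sin t)). nra. }
  assert (Hb4 : Rabs c <= e * m) by nra.
  pose proof (Rabs_triang (a * cos t) ((1 + s) * b)).
  pose proof (Rabs_triang ((s + a) * sin t) c).
  assert (0 <= m) by apply Cmod_ge_0. nra.
Qed.

Lemma cderiv_cexp z : cderiv cexp z (cexp z).
Proof.
  assert (E0 : cderiv cexp (- z + 1 * z)%C 1%C).
  { replace (- z + 1 * z)%C with (RtoC 0) by ring. exact cderiv_cexp_0. }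
  pose proof (cderiv_mult (fun _ => cexp z) _ z _ _ (cderiv_const _ z)
    (cderiv_comp cexp (fun w => - z + 1 * w)%C z _ _ E0
       (cderiv_affine _ _ _))) as D.
  replace (cexp z) with
    (0 * cexp (- z + 1 * z) + cexp z * (1 * 1))%C by ring.
  revert D. apply is_derive_ext. intros w. rewrite <- cexp_plus. f_equal. ring.
Qed.

(** * The mean value inequality on the disc *)

(** In the variable zeta = cexp tau this is g times 1 + (zeta + 1 / zeta) / 2.  On
    the unit circle the factor is the nonnegative weight 1 + cos t, and
    its terms select the Taylor coefficients of g of order 0 and 1. *)
Definition weighted (g : C -> C) (tau : C) : C :=
  (g (cexp tau) * (1 + RtoC (/ 2) * (cexp tau + cexp (0 + - (1) * tau))))%C.

Lemma cderiv_weighted g tau e : cderiv g (cexp tau) e ->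
  exists e', cderiv (weighted g) tau e'.
Proof.
  intros Hg. eexists. apply cderiv_mult.
  - apply cderiv_comp; [exact Hg|apply cderiv_cexp].
  - apply cderiv_plus; [apply cderiv_const|].
    apply cderiv_mult; [apply cderiv_const|].
    apply cderiv_plus; [apply cderiv_cexp|].
    apply cderiv_comp; [apply cderiv_cexp|apply cderiv_affine].
Qed.

Lemma cexp_2PI s : cexp ((s, (2 * PI)%R) : C) = cexp (s, 0).
Proof. unfold cexp. simpl. now rewrite cos_2PI, sin_2PI, cos_0, sin_0. Qed.

Lemma cexp_neg s t :
  cexp (0 + - (1) * (s, t))%C = (exp (- s) * cos t, - (exp (- s) * sin t)).
Proof.
  replace (0 + - (1) * (s, t))%C with ((- s, - t) : C)
    by (apply injective_projections; simpl; ring).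
  unfold cexp. simpl. rewrite cos_neg, sin_neg.
  apply injective_projections; simpl; ring.
Qed.

Lemma weighted_circle g t :
  Im (weighted g (0, t)) = Im (g (cexp (0, t))) * (1 + cos t).
Proof.
  unfold weighted. set (u := g (cexp (0, t))). rewrite cexp_neg. unfold cexp.
  simpl. rewrite Ropp_0, exp_0. unfold Im, Re. field.
Qed.

(** Near zeta = 0 the product g * (1 + (zeta + 1 / zeta) / 2) equals
    g(0) + g'(0) / 2 + g(0) / (2 zeta) up to o(1).  The unbounded last term is
    kept: its mean over a circle around 0 vanishes. *)
Lemma weighted_near_0 g d eps : cderiv g 0%C d -> 0 < eps ->
  exists s, s < 0 /\ forall t,
    Im (weighted g (s, t)) <= Im (g 0%C) + Im d / 2 + eps
      + / 2 * exp (- s) * (Im (g 0%C) * cos t - Re (g 0%C) * sin t).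
Proof.
  intros Hg He. rewrite cderivP in Hg.
  destruct (Hg (eps / 4)) as [dl [dl0 Hd]]; [lra|].
  set (g0 := g 0%C) in *. set (K := Cmod g0 + 2 * Cmod d + 1).
  pose proof (Cmod_ge_0 g0). pose proof (Cmod_ge_0 d).
  assert (K0 : 0 < K) by (unfold K; lra).
  (* The error is at most eps / 2 from the remainder of g at 0 and rho * K from
     the terms of order rho. *)
  set (rho := Rmin (/ 2) (Rmin (dl / 2) (eps / (2 * K)))).
  assert (r0 : 0 < rho).
  { repeat apply Rmin_pos; try lra. apply Rdiv_lt_0_compat; lra. }
  assert (r1 : rho <= / 2) by apply Rmin_l.
  assert (r2 : rho <= Rmin (dl / 2) (eps / (2 * K))) by apply Rmin_r.
  assert (r3 : rho < dl).
  { eapply Rle_lt_trans; [exact r2|].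
    eapply Rle_lt_trans; [apply Rmin_l|lra]. }
  assert (r4 : rho * K <= eps / 2).
  { replace (eps / 2) with (eps / (2 * K) * K) by (field; lra).
    apply Rmult_le_compat_r; [lra|].
    eapply Rle_trans; [exact r2|apply Rmin_r]. }
  exists (ln rho). split.
  { rewrite <- ln_1. apply ln_increasing; lra. }
  intros t. set (z := cexp (ln rho, t)).
  set (z' := cexp (0 + - (1) * (ln rho, t))%C).
  assert (Ez : (z * z' = 1)%C).
  { unfold z, z'. rewrite <- cexp_plus.
    replace ((ln rho, t) + (0 + - (1) * (ln rho, t)))%C with (RtoC 0) by ring.
    unfold cexp. simpl. rewrite exp_0, cos_0, sin_0.
    apply injective_projections; simpl; ring. }
  assert (Mz : Cmod z = rho) by (unfold z; rewrite Cmod_cexp; now apply exp_ln).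
  assert (Mz' : Cmod z' = / rho).
  { apply Rmult_eq_reg_l with rho; [|lra]. rewrite Rinv_r by lra.
    rewrite <- Mz at 1. rewrite <- Cmod_mult, Ez. apply Cmod_1. }
  specialize (Hd z). replace (z - 0)%C with z in Hd by ring. rewrite Mz in Hd.
  specialize (Hd r3). fold g0 in Hd.
  set (E := (g z - g0 - z * d)%C) in *.
  set (k := (1 + RtoC (/ 2) * (z + z'))%C).
  assert (Mk : Cmod k <= 2 / rho).
  { unfold k. eapply Rle_trans; [apply Cmod_triangle|].
    rewrite Cmod_1, Cmod_mult, Cmod_R, Rabs_pos_eq by lra.
    pose proof (Cmod_triangle z z') as Ht. rewrite Mz, Mz' in Ht.
    assert (1 <= / rho) by (rewrite <- Rinv_1; apply Rinv_le_contravar; lra).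
    unfold Rdiv. lra. }
  assert (Ew : weighted g (ln rho, t) =
    (g0 + RtoC (/ 2) * d + RtoC (/ 2) * (z' * g0)
       + (RtoC (/ 2) * (z * g0) + z * d + RtoC (/ 2) * (z * z * d) + E * k))%C).
  { unfold weighted. fold z z'. 
    replace (g z) with (E + g0 + z * d)%C by (unfold E; ring).
    fold k.
    transitivity (E * k + (g0 + z * d) * k)%C; [ring|].
    unfold k.
    transitivity (E * (1 + RtoC (/ 2) * (z + z')) + g0 + RtoC (/ 2) * (z * g0)
      + RtoC (/ 2) * (z' * g0) + z * d + RtoC (/ 2) * (z * z * d)
      + RtoC (/ 2) * ((z * z') * d))%C; [ring|]. rewrite Ez. ring. }
  rewrite Ew.
  set (Er := (RtoC (/ 2) * (z * g0) + z * d + RtoC (/ 2) * (z * z * d) + E * k)%C).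
  assert (HEr : Cmod Er <= eps).
  { unfold Er.
    eapply Rle_trans; [apply Cmod_triangle|].
    assert (Cmod (E * k) <= eps / 2).
    { rewrite Cmod_mult. replace (eps / 2) with (eps / 4 * rho * (2 / rho)) by (field; lra).
      apply Rmult_le_compat; auto using Cmod_ge_0. }
    pose proof (Cmod_triangle (RtoC (/ 2) * (z * g0) + z * d) (RtoC (/ 2) * (z * z * d))) as T1.
    pose proof (Cmod_triangle (RtoC (/ 2) * (z * g0)) (z * d)) as T2.
    rewrite !Cmod_mult, Cmod_R, Rabs_pos_eq, Mz in T1 by lra.
    rewrite !Cmod_mult, Cmod_R, Rabs_pos_eq, Mz in T2 by lra.
    unfold K in r4. nra. }
  pose proof (Im_le_Cmod Er) as HI. apply Rabs_le_between in HI.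
  assert (EI : Im (g0 + RtoC (/ 2) * d + RtoC (/ 2) * (z' * g0) + Er)%C
     = Im g0 + Im d / 2 + / 2 * Im (z' * g0)%C + Im Er).
  { simpl. unfold Im, Re. field. }
  rewrite EI.
  assert (EI2 : Im (z' * g0)%C = exp (- ln rho) * (Im g0 * cos t - Re g0 * sin t)).
  { unfold z'. rewrite cexp_neg. simpl. unfold Im, Re. ring. }
  rewrite EI2. lra.
Qed.

Lemma is_RInt_trig k A B :
  is_RInt (fun t => k + (A * cos t - B * sin t)) 0 (2 * PI) (2 * PI * k).
Proof.
  replace (2 * PI * k) with
    (minus (k * (2 * PI) + (A * sin (2 * PI) + B * cos (2 * PI)))
           (k * 0 + (A * sin 0 + B * cos 0))).
  - apply (is_RInt_derive (V := R_CompleteNormedModule)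
             (fun t => k * t + (A * sin t + B * cos t))).
    + intros t _. auto_derive; [easy|ring].
    + intros t _. apply (ex_derive_continuous (V := R_NormedModule)).
      auto_derive. easy.
  - rewrite cos_2PI, sin_2PI, cos_0, sin_0. unfold minus, plus, opp; simpl. ring.
Qed.

(** The integral of [Im (weighted g (s, t))] over t in [0, 2 pi] does not depend
    on s <= 0: the flux through [s, 0] x [0, 2 pi] vanishes, and the two
    horizontal sides cancel by periodicity.  At s = 0 it is
    nonnegative; as s tends to minus infinity it approaches
    2 pi (Im g(0) + Im g'(0) / 2). *)
Lemma disc_inequality g d :
  (forall z, Cmod z <= 1 -> exists e, cderiv g z e) -> cderiv g 0%C d ->
  (forall z, Cmod z = 1 -> 0 <= Im (g z)) ->
  0 <= Im (g 0%C) + Im d / 2.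
Proof.
  intros Hol Hd Hpos. apply Rnot_lt_le. intros Hneg.
  set (k := Im (g 0%C) + Im d / 2) in *.
  destruct (weighted_near_0 g d (- k / 2) Hd ltac:(lra)) as [s [s0 Hs]].
  fold k in Hs.
  pose proof PI_RGT_0 as Hpi.
  set (P := fun u v => Re (weighted g (u, v))).
  set (Q := fun u v => Im (weighted g (u, v))).
  assert (D : forall x y, s <= x <= 0 -> 0 <= y <= 2 * PI ->
    divergence_free_at P Q x y).
  { intros x y Hx _.
    destruct (Hol (cexp (x, y))) as [e He].
    - rewrite Cmod_cexp. simpl. rewrite <- exp_0. destruct (Req_dec x 0) as [->|].
      + lra.
      + apply Rlt_le, exp_increasing. lra.
    - destruct (cderiv_weighted g (x, y) e He) as [e' He'].
      exact (cderiv_divergence_free _ _ _ _ He'). }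
  pose proof (divergence_free_flux P Q s 0 0 (2 * PI) s0 ltac:(lra) D) as F0.
  destruct (differentiable_slices P Q s 0 0 (2 * PI) D ltac:(lra) ltac:(lra))
    as [_ SQ].
  unfold flux in F0.
  rewrite (RInt_ext _ (fun _ => 0)) in F0.
  2:{ intros x _. unfold P, weighted. rewrite !cexp_neg, cexp_2PI, cos_2PI, sin_2PI, cos_0, sin_0.
    apply Rminus_diag. }
  rewrite RInt_const in F0.
  rewrite (RInt_minus (V := R_CompleteNormedModule) (fun y => Q 0 y) (fun y => Q s y))
    in F0 by (apply SQ; lra).
  unfold scal, minus, plus, opp in F0; simpl in F0. unfold mult in F0; simpl in F0.
  assert (I0 : 0 <= RInt (fun y => Q 0 y) 0 (2 * PI)).
  { apply RInt_ge_0; [lra|apply SQ; lra|]. intros t _. unfold Q.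
    rewrite weighted_circle. pose proof (COS_bound t).
    apply Rmult_le_pos; [|lra]. apply Hpos. rewrite Cmod_cexp. apply exp_0. }
  pose proof (is_RInt_trig (k + - k / 2) (/ 2 * exp (- s) * Im (g 0%C))
     (/ 2 * exp (- s) * Re (g 0%C))) as IT.
  assert (I1 : RInt (fun y => Q s y) 0 (2 * PI) <= 2 * PI * (k + - k / 2)).
  { rewrite <- (is_RInt_unique _ _ _ _ IT).
    apply RInt_le; [lra|apply SQ; lra|eexists; exact IT|].
    intros t _. unfold Q. eapply Rle_trans; [apply Hs|]. lra. }
  nra.
Qed.

(** * Harnack's inequality for Nevanlinna functions *)

Definition nevanlinna (f : C -> C) : Prop :=
  (forall z, 0 < Im z -> exists d, cderiv f z d) /\
  (forall z, 0 < Im z -> 0 <= Im (f z)).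

(** [disc_inequality] for [zeta => f (w + k * zeta)] with k of modulus Im w / 2,
    and phase chosen so that k f'(w) = - i |k f'(w)|. *)
Lemma nevanlinna_derivative_bound f w d : nevanlinna f -> 0 < Im w ->
  cderiv f w d -> Cmod d <= 4 / Im w * Im (f w).
Proof.
  intros [Hol Hpos] Hw Hd.
  destruct (Req_dec (Cmod d) 0) as [E|E].
  { rewrite E. apply Rmult_le_pos; [|auto]. apply Rdiv_le_0_compat; lra. }
  pose proof (Cmod_ge_0 d) as Hd0.
  set (r := Im w / 2). assert (r0 : 0 < r) by (unfold r; lra).
  set (k := (RtoC (r / Cmod d) * (- Ci * Cconj d))%C).
  assert (Mk : Cmod k = r).
  { unfold k. rewrite !Cmod_mult, Cmod_R, Cmod_opp, Cmod_Ci, Cmod_conj.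
    rewrite Rabs_pos_eq by (apply Rdiv_le_0_compat; lra). field. lra. }
  assert (Hin : forall z, Cmod z <= 1 -> 0 < Im (w + k * z)%C).
  { intros z Hz. pose proof (Im_le_Cmod (k * z)%C) as Hi.
    rewrite Cmod_mult, Mk in Hi. apply Rabs_le_between in Hi.
    assert (r * Cmod z <= r) by nra.
    change (Im (w + k * z)%C) with (Im w + Im (k * z)%C). unfold r in *. lra. }
  assert (H0 : (w + k * 0)%C = w) by ring.
  pose proof (disc_inequality (fun z => f (w + k * z)%C) (k * d)%C) as Hdisc.
  cbv beta in Hdisc. rewrite H0 in Hdisc.
  assert (Hk : Im (k * d)%C = - (r * Cmod d)).
  { pose proof (Cmod2_alt d) as E2. unfold k.
    replace (Im (RtoC (r / Cmod d) * (- Ci * Cconj d) * d)%C)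
      with (- (r / Cmod d * (Re d ^ 2 + Im d ^ 2)))
      by (simpl; unfold Re, Im; ring).
    rewrite <- E2. field. lra. }
  rewrite Hk in Hdisc.
  assert (Hfin : 0 <= Im (f w) + - (r * Cmod d) / 2).
  { apply Hdisc.
    - intros z Hz. destruct (Hol _ (Hin z Hz)) as [e He].
      eexists. apply cderiv_comp; [exact He|apply cderiv_affine].
    - apply cderiv_comp; [now rewrite H0|apply cderiv_affine].
    - intros z Hz. apply Hpos, Hin. lra. }
  unfold r in Hfin. apply Rmult_le_reg_l with (Im w / 4); [lra|].
  replace (Im w / 4 * (4 / Im w * Im (f w))) with (Im (f w)) by (field; lra). lra.
Qed.

Lemma cderiv_along_line f w v t d : cderiv f (w + v * RtoC t)%C d ->
  is_derive (fun u => Re (f (w + v * RtoC u)%C)) t (Re (v * d)%C) /\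
  is_derive (fun u => Im (f (w + v * RtoC u)%C)) t (Im (v * d)%C).
Proof.
  intros Hf.
  assert (H : cderiv (fun u => f (w + v * u)%C) (RtoC t) (v * d)%C)
    by (apply cderiv_comp; [exact Hf|apply cderiv_affine]).
  rewrite cderivP in H.
  split; apply is_derive_Reals; intros eps He;
    destruct (H (eps / 2)) as [dl [dl0 Hd]]; try lra;
    exists (mkposreal dl dl0); intros h Hh Hhd; simpl in Hhd;
    specialize (Hd (RtoC (t + h)));
    replace (RtoC (t + h) - RtoC t)%C with (RtoC h) in Hd
      by (apply injective_projections; simpl; ring);
    rewrite Cmod_R in Hd; specialize (Hd Hhd);
    pose proof (Rabs_pos_lt h Hh).
  - match goal with |- Rabs ?X < _ => replace X with
      (Re (f (w + v * RtoC (t + h)) - f (w + v * RtoC t) - RtoC h * (v * d))%C / h)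
      by (simpl; unfold Re, Im; field; assumption) end.
    pose proof (Rle_trans _ _ _ (re_le_Cmod _) Hd) as Hr.
    unfold Rdiv. rewrite Rabs_mult, Rabs_inv.
    apply Rmult_lt_reg_r with (Rabs h); [assumption|].
    rewrite Rmult_assoc, Rinv_l by lra. nra.
  - match goal with |- Rabs ?X < _ => replace X with
      (Im (f (w + v * RtoC (t + h)) - f (w + v * RtoC t) - RtoC h * (v * d))%C / h)
      by (simpl; unfold Re, Im; field; assumption) end.
    pose proof (Rle_trans _ _ _ (Im_le_Cmod _) Hd) as Hr.
    unfold Rdiv. rewrite Rabs_mult, Rabs_inv.
    apply Rmult_lt_reg_r with (Rabs h); [assumption|].
    rewrite Rmult_assoc, Rinv_l by lra. nra.
Qed.

Lemma increment_bound f (df : R -> R) K :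
  (forall t, 0 <= t <= 1 -> is_derive f t (df t)) ->
  (forall t, 0 <= t <= 1 -> Rabs (df t) <= K) -> Rabs (f 1 - f 0) <= K.
Proof.
  intros Hf HK.
  destruct (MVT_gen f 0 1 df) as [c [Hc E]].
  - rewrite Rmin_left, Rmax_right by lra. intros t Ht. apply Hf. lra.
  - rewrite Rmin_left, Rmax_right by lra. intros t Ht.
    apply derivable_continuous_pt. exists (df t). now apply is_derive_Reals, Hf.
  - rewrite Rmin_left, Rmax_right in Hc by lra.
    rewrite E. rewrite Rminus_0_r, Rmult_1_r. now apply HK.
Qed.

Lemma gronwall y dy L : 
  (forall t, 0 <= t <= 1 -> is_derive y t (dy t)) ->
  (forall t, 0 <= t <= 1 -> dy t <= L * y t) ->
  forall t, 0 <= t <= 1 -> y t <= exp (L * t) * y 0.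
Proof.
  intros Hy HL t Ht.
  destruct (Req_dec t 0) as [->|Ht0].
  { rewrite Rmult_0_r, exp_0. lra. }
  (* exp (- L s) * y s is nonincreasing. *)
  pose (h := fun s => exp (- (L * s)) * y s).
  pose (dh := fun s => exp (- (L * s)) * (dy s - L * y s)).
  assert (Dh : forall s, 0 <= s <= 1 -> is_derive h s (dh s)).
  { intros s Hs. unfold h, dh. specialize (Hy s Hs).
    auto_derive; [now exists (dy s)|]. 
    replace (Derive (fun u => y u) s) with (dy s)
      by (symmetry; now apply is_derive_unique). ring. }
  destruct (MVT_gen h 0 t dh) as [c [Hc E]].
  - rewrite Rmin_left, Rmax_right by lra. intros s Hs. apply Dh. lra.
  - rewrite Rmin_left, Rmax_right by lra. intros s Hs.
    apply derivable_continuous_pt. exists (dh s). apply is_derive_Reals, Dh. lra.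
  - rewrite Rmin_left, Rmax_right in Hc by lra.
    specialize (HL c ltac:(lra)). pose proof (exp_pos (- (L * c))).
    assert (dh c <= 0) by (unfold dh; nra).
    assert (Hle : h t <= h 0) by nra.
    unfold h in Hle. rewrite Rmult_0_r, Ropp_0, exp_0, Rmult_1_l in Hle.
    apply Rmult_le_reg_l with (exp (- (L * t))); [apply exp_pos|].
    rewrite <- Rmult_assoc, <- exp_plus.
    replace (- (L * t) + L * t) with 0 by ring. rewrite exp_0. lra.
Qed.

(** Along the segment from w to z the derivative bound reads
    |y'| <= L Im y, so Im y grows at most exponentially, and then so does the
    increment of y.  The constant involves z and w only. *)
Lemma nevanlinna_harnack z w : 0 < Im z -> 0 < Im w ->
  exists K, 0 <= K /\ forall f, nevanlinna f -> Cmod (f z - f w)%C <= K * Im (f w).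
Proof.
  intros Hz Hw.
  set (m := Rmin (Im z) (Im w)). assert (m0 : 0 < m) by now apply Rmin_pos.
  set (v := (z - w)%C). pose proof (Cmod_ge_0 v) as v0.
  set (L := Cmod v * (4 / m)).
  assert (L0 : 0 <= L) by (apply Rmult_le_pos; [lra|apply Rdiv_le_0_compat; lra]).
  pose proof (exp_pos L) as eL.
  exists (2 * (L * exp L)). split; [nra|].
  intros f Hf. pose proof Hf as [Hol Hpos].
  pose (p := fun t => (w + v * RtoC t)%C).
  assert (Ip : forall t, Im (p t) = Im w + (Im z - Im w) * t).
  { intros t. unfold p, v. simpl. unfold Im, Re. ring. }
  assert (Hm : forall t, 0 <= t <= 1 -> m <= Im (p t)).
  { intros t Ht. rewrite Ip. pose proof (Rmin_l (Im z) (Im w)).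
    pose proof (Rmin_r (Im z) (Im w)). change (m <= Im z) in H. change (m <= Im w) in H0. nra. }
  assert (Hd : forall t, exists d, 0 <= t <= 1 -> cderiv f (p t) d).
  { intros t. destruct (Rlt_dec 0 (Im (p t))) as [Hp|Hp].
    - destruct (Hol _ Hp) as [d Hd]. now exists d.
    - exists 0%C. intros Ht. specialize (Hm t Ht). lra. }
  destruct (functional_choice _ Hd) as [df Hdf].
  assert (Hb : forall t, 0 <= t <= 1 -> Cmod (v * df t)%C <= L * Im (f (p t))).
  { intros t Ht. specialize (Hm t Ht). rewrite Cmod_mult. unfold L.
    rewrite Rmult_assoc. apply Rmult_le_compat_l; [assumption|].
    eapply Rle_trans.
    - apply (nevanlinna_derivative_bound f (p t)); auto. lra.
    - apply Rmult_le_compat_r; [apply Hpos; lra|].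
      apply Rmult_le_compat_l; [lra|]. apply Rinv_le_contravar; lra. }
  assert (p0 : p 0 = w) by (unfold p; ring).
  assert (p1 : p 1 = z) by (unfold p, v; ring).
  assert (Hg : forall t, 0 <= t <= 1 -> Im (f (p t)) <= exp L * Im (f w)).
  { intros t Ht.
    pose proof (gronwall (fun t => Im (f (p t))) (fun t => Im (v * df t)%C) L) as G.
    cbv beta in G. rewrite p0 in G.
    eapply Rle_trans; [apply G; try assumption|].
    - intros s Hs. apply (cderiv_along_line f w v s (df s)). now apply Hdf.
    - intros s Hs. specialize (Hb s Hs).
      pose proof (Im_le_Cmod (v * df s)%C) as Hi. apply Rabs_le_between in Hi.
      lra.
    - apply Rmult_le_compat_r; [now apply Hpos|].
      destruct (Req_dec (L * t) L) as [->|]; [lra|].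
      apply Rlt_le, exp_increasing. nra. }
  assert (Hb2 : forall t, 0 <= t <= 1 -> Cmod (v * df t)%C <= L * exp L * Im (f w)).
  { intros t Ht. eapply Rle_trans; [now apply Hb|]. rewrite Rmult_assoc.
    apply Rmult_le_compat_l; auto. }
  eapply Rle_trans; [apply Cmod_le_abs|].
  assert (B1 : Rabs (Re (f z) - Re (f w)) <= L * exp L * Im (f w)).
  { rewrite <- p1, <- p0 at 1.
    apply (increment_bound (fun t => Re (f (p t))) (fun t => Re (v * df t)%C)).
    - intros t Ht. apply (cderiv_along_line f w v t (df t)). now apply Hdf.
    - intros t Ht. eapply Rle_trans; [apply re_le_Cmod|auto]. }
  assert (B2 : Rabs (Im (f z) - Im (f w)) <= L * exp L * Im (f w)).
  { rewrite <- p1, <- p0 at 1.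
    apply (increment_bound (fun t => Im (f (p t))) (fun t => Im (v * df t)%C)).
    - intros t Ht. apply (cderiv_along_line f w v t (df t)). now apply Hdf.
    - intros t Ht. eapply Rle_trans; [apply Im_le_Cmod|auto]. }
  change (Re (f z - f w)%C) with (Re (f z) - Re (f w)).
  change (Im (f z - f w)%C) with (Im (f z) - Im (f w)). lra.
Qed.

(** * Hilbert space preliminaries *)

Section Hilbert.
Context {H : HilbertSpace}.
Implicit Types (x y z u v : H) (T S : BOp H).

(** Stated as an equality in H itself: the zero of the underlying abelian group is
    a convertible but syntactically different term, which [rewrite] misses. *)
Lemma minus_diag x : @eq H (minus x x) zero.
Proof. exact (minus_eq_zero (G := hilbert_space H) x). Qed.

Lemma inner_zero_r z : inner z zero = RtoC 0.
Proof.
  rewrite <- (minus_diag z), inner_minus_r.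
  apply injective_projections; simpl; ring.
Qed.

Lemma norm_0_inv x : norm x = 0 -> x = zero.
Proof. exact (norm_eq_zero (V := H) x). Qed.

Lemma norm_scalH (k : C) x : norm (scal k x) = Cmod k * norm x.
Proof.
  pose proof (norm_scal_sqr k x) as E. rewrite <- Rpow_mult_distr in E.
  pose proof (norm_geH (scal k x)). pose proof (norm_geH x).
  pose proof (Cmod_ge_0 k).
  apply Rsqr_inj; [assumption|now apply Rmult_le_pos|].
  rewrite !Rsqr_pow2. exact E.
Qed.

Lemma cauchy_schwarz x y : Cmod (inner x y) <= norm x * norm y.
Proof.
  set (w := inner x y).
  pose proof (rin_le (scal (Cconj w) x) y) as Hr.
  rewrite inner_scal_l in Hr. fold w in Hr.
  rewrite norm_scalH, Cmod_conj in Hr.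
  pose proof (norm_geH x). pose proof (norm_geH y). pose proof (Cmod_ge_0 w).
  assert (E2 : Re (Cconj w * w)%C = Cmod w ^ 2).
  { rewrite Cmod2_alt. simpl. unfold Re, Im. ring. }
  rewrite E2 in Hr.
  destruct (Req_dec (Cmod w) 0) as [->|Hw]; nra.
Qed.

Lemma op_bound T : exists M, 0 < M /\ forall x, norm (T x) <= M * norm x.
Proof. exact (linear_norm _ (op_linear T)). Qed.

Lemma op_plus T x y : T (plus x y) = plus (T x) (T y).
Proof. exact (linear_plus _ (op_linear T) x y). Qed.

Lemma op_scal T (k : C) x : T (scal k x) = scal k (T x).
Proof. exact (linear_scal _ (op_linear T) k x). Qed.

Lemma op_minus T x y : T (minus x y) = minus (T x) (T y).
Proof. unfold minus. now rewrite op_plus, !opp_scal, op_scal. Qed.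

Ltac hvec := apply inner_ext; intros;
  repeat (rewrite inner_minus_r || rewrite inner_plus_r || rewrite inner_opp_r ||
          rewrite inner_scal_r || rewrite inner_zero_r);
  apply injective_projections; simpl; unfold Re, Im; try field.

Lemma norm_minus_sym x y : norm (minus x y) = norm (minus y x).
Proof. rewrite <- norm_oppH. f_equal. hvec. Qed.

Lemma norm_minus_triangle x y z :
  norm (minus x z) <= norm (minus x y) + norm (minus y z).
Proof.
  eapply Rle_trans; [|apply norm_triangleH]. apply Req_le. f_equal. hvec.
Qed.

Lemma harmonic_small eps : 0 < eps ->
  exists N : nat, forall n, (N <= n)%nat -> / (INR n + 1) < eps.
Proof.
  intros He. destruct (archimed_cor1 eps He) as [N [HN N0]].
  exists N. intros n Hn. eapply Rle_lt_trans; [|exact HN].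
  apply lt_INR in N0. apply le_INR in Hn. simpl in N0.
  apply Rinv_le_contravar; lra.
Qed.

(** Completeness in terms of norms of differences, free of filters. *)
Lemma hilbert_complete (u : nat -> H) :
  (forall eps, 0 < eps -> exists N : nat, forall n m, (N <= n)%nat ->
     (N <= m)%nat -> norm (minus (u n) (u m)) < eps) ->
  exists l : H, forall eps, 0 < eps -> exists N : nat, forall n, (N <= n)%nat ->
     norm (minus (u n) l) < eps.
Proof.
  intros Hu.
  destruct (proj1 (filterlim_locally_cauchy (U := hilbert_space H)
    (F := eventually) u)) as [l Hl].
  { intros eps. destruct (Hu eps (cond_pos eps)) as [N HN].
    exists (fun n => (N <= n)%nat). split; [now exists N|].
    intros n m Hn Hm. apply norm_compat1H. now apply HN. }
  exists l. intros eps He.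
  pose proof (@norm_factor_gt_0 _ (hilbert_space H)) as Hnf.
  assert (He' : 0 < eps / @norm_factor _ (hilbert_space H))
    by now apply Rdiv_lt_0_compat.
  destruct (proj1 (filterlim_locally u l) Hl (mkposreal _ He')) as [N HN].
  exists N. intros n Hn. specialize (HN n Hn). apply norm_compat2H in HN.
  simpl in HN. replace (norm_factor * (eps / norm_factor)) with eps in HN
    by (field; lra).
  exact HN.
Qed.

(** * Kernels, ranges and bounded inverses *)

Definition kernel_trivial (f : H -> H) : Prop := forall x, f x = zero -> x = zero.

Definition bounded_below (f : H -> H) : Prop :=
  exists c, 0 < c /\ forall x, c * norm x <= norm (f x).

(** Evaluating at t = - b / (q + 1), rather than - b / q, also covers q = 0. *)
Lemma quadratic_nonneg_discriminant e b q : 0 <= q ->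
  (forall t, 0 <= e + 2 * t * b + t ^ 2 * q) -> b ^ 2 <= e * (q + 1).
Proof.
  intros Hq Ht. specialize (Ht (- b / (q + 1))).
  replace (e + 2 * (- b / (q + 1)) * b + (- b / (q + 1)) ^ 2 * q)
    with ((e * (q + 1) - b ^ 2 - b ^ 2 / (q + 1)) / (q + 1)) in Ht by (field; lra).
  assert (Hn : 0 <= e * (q + 1) - b ^ 2 - b ^ 2 / (q + 1)).
  { replace (e * (q + 1) - b ^ 2 - b ^ 2 / (q + 1)) with
      ((e * (q + 1) - b ^ 2 - b ^ 2 / (q + 1)) / (q + 1) * (q + 1)) by (field; lra).
    apply Rmult_le_pos; lra. }
  assert (0 <= b ^ 2 / (q + 1)) by (apply Rdiv_le_0_compat; nra). lra.
Qed.

(** The residuals of a minimizing sequence for the distance from y to the range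
    form a Cauchy sequence by the parallelogram identity.  Their limit is orthogonal
    to the range, that is in the kernel of the adjoint, hence 0. *)
Lemma dense_range T : kernel_trivial (adjoint T) ->
  forall y eps, 0 < eps -> exists x, norm (minus (T x) y) < eps.
Proof.
  intros Hker y.
  destruct (completeness (fun r => exists x, r = - norm (minus (T x) y) ^ 2))
    as [s [sub slub]].
  { exists 0. intros r [x ->]. pose proof (pow2_ge_0 (norm (minus (T x) y))). lra. }
  { exists (- norm (minus (T zero) y) ^ 2). now exists zero. }
  assert (slow : forall x, - s <= norm (minus (T x) y) ^ 2).
  { intros x. assert (- norm (minus (T x) y) ^ 2 <= s); [|lra].
    apply sub. now exists x. }
  assert (Hmin : forall n : nat, exists x,
    norm (minus (T x) y) ^ 2 < - s + / (INR n + 1)).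
  { intros n. apply NNPP. intros Hn.
    pose proof (pos_INR n) as Hn0.
    assert (0 < / (INR n + 1)) by (apply Rinv_0_lt_compat; lra).
    assert (s <= s - / (INR n + 1)); [|lra]. apply slub. intros r [x ->].
    apply Rnot_lt_le. intros Hl. apply Hn. exists x. lra. }
  apply functional_choice in Hmin. destruct Hmin as [x Hx].
  set (r := (fun n => minus (T (x n)) y) : nat -> H).
  assert (Hr : forall n, norm (r n) ^ 2 < - s + / (INR n + 1)) by exact Hx.
  destruct (hilbert_complete r) as [l Hl].
  { intros eps He. destruct (harmonic_small (eps ^ 2 / 4) ltac:(nra)) as [N HN].
    exists N. intros n m Hn Hm. specialize (HN _ Hn) as Hn'. specialize (HN _ Hm).
    pose proof (Hr n) as H1. pose proof (Hr m) as H2.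
    pose proof (slow (scal (RtoC (/ 2)) (plus (x n) (x m)))) as H3.
    replace (minus (T (scal (RtoC (/ 2)) (plus (x n) (x m)))) y)
      with (scal (RtoC (/ 2)) (plus (r n) (r m))) in H3.
    2:{ unfold r. rewrite op_scal, op_plus. hvec. }
    rewrite norm_scal_sqr, Cmod_R, Rabs_pos_eq, norm_plus_sqr in H3 by lra.
    pose proof (norm_minus_sqr (r n) (r m)).
    pose proof (norm_geH (minus (r n) (r m))). nra. }
  assert (Hl0 : l = zero).
  { apply Hker. set (v := adjoint T l). set (q := norm (T v) ^ 2).
    assert (q0 : 0 <= q) by apply pow2_ge_0.
    assert (Hb : forall n, Re (inner (r n) (T v)) ^ 2 <= / (INR n + 1) * (q + 1)).
    { intros n. apply quadratic_nonneg_discriminant; [assumption|]. intros t.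
      pose proof (slow (plus (x n) (scal (RtoC t) v))) as H3.
      replace (minus (T (plus (x n) (scal (RtoC t) v))) y)
        with (plus (r n) (scal (RtoC t) (T v))) in H3.
      2:{ unfold r. rewrite op_plus, op_scal. hvec. }
      rewrite norm_plus_sqr, norm_scal_sqr, Cmod_R, inner_scal_r, pow2_abs in H3.
      fold q in H3. specialize (Hr n).
      replace (Re (Cconj (RtoC t) * inner (r n) (T v))%C)
        with (t * Re (inner (r n) (T v))) in H3 by (simpl; unfold Re; ring).
      lra. }
    assert (Hv : Re (inner l (T v)) = norm v ^ 2).
    { rewrite rin_sym, adjoint_correct. fold v. apply rin_norm. }
    apply norm_0_inv. pose proof (norm_geH v) as Hv0.
    destruct (Req_dec (norm v) 0) as [E|E]; [exact E|exfalso].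
    set (k := norm v ^ 2) in *. assert (k0 : 0 < k) by (unfold k; nra).
    pose proof (norm_geH (T v)) as Tv0.
    destruct (Hl (k / 2 / (norm (T v) + 1))) as [N1 HN1].
    { apply Rdiv_lt_0_compat; lra. }
    destruct (harmonic_small (k ^ 2 / 4 / (q + 1))) as [N2 HN2].
    { apply Rdiv_lt_0_compat; nra. }
    specialize (HN1 _ (Nat.le_max_l N1 N2)). specialize (HN2 _ (Nat.le_max_r N1 N2)).
    set (n := Nat.max N1 N2) in *. specialize (Hb n).
    pose proof (rin_le (minus l (r n)) (T v)) as Hc.
    rewrite inner_minus_l in Hc.
    replace (Re (inner l (T v) - inner (r n) (T v))%C) with
      (k - Re (inner (r n) (T v))) in Hc by (rewrite <- Hv; simpl; unfold Re; ring).
    rewrite norm_minus_sym in Hc.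
    assert (norm (minus (r n) l) * (norm (T v) + 1) < k / 2).
    { replace (k / 2) with (k / 2 / (norm (T v) + 1) * (norm (T v) + 1)) by (field; lra).
      apply Rmult_lt_compat_r; lra. }
    assert (/ (INR n + 1) * (q + 1) < k ^ 2 / 4).
    { replace (k ^ 2 / 4) with (k ^ 2 / 4 / (q + 1) * (q + 1)) by (field; lra).
      apply Rmult_lt_compat_r; lra. }
    pose proof (norm_geH (minus (r n) l)). nra. }
  intros eps He. destruct (Hl eps He) as [N HN]. exists (x N).
  specialize (HN N (le_n N)). rewrite Hl0 in HN.
  replace (minus (T (x N)) y) with (minus (r N) zero) by (unfold r; hvec).
  exact HN.
Qed.

(** Approximate preimages of y form a Cauchy sequence. *)
Lemma bounded_below_surjective T : bounded_below T ->
  (forall y eps, 0 < eps -> exists x, norm (minus (T x) y) < eps) ->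
  forall y, exists x, T x = y.
Proof.
  intros [c [c0 Hc]] Hd y.
  assert (Hx : forall n : nat, exists x, norm (minus (T x) y) < / (INR n + 1)).
  { intros n. apply Hd. apply Rinv_0_lt_compat. pose proof (pos_INR n). lra. }
  apply functional_choice in Hx. destruct Hx as [x Hx].
  destruct (hilbert_complete x) as [l Hl].
  { intros eps He. destruct (harmonic_small (c * eps / 2) ltac:(nra)) as [N HN].
    exists N. intros n m Hn Hm.
    specialize (HN _ Hn) as Hn'. specialize (HN _ Hm).
    pose proof (Hx n). pose proof (Hx m). specialize (Hc (minus (x n) (x m))).
    rewrite op_minus in Hc.
    pose proof (norm_minus_triangle (T (x n)) y (T (x m))) as Ht.
    rewrite (norm_minus_sym y (T (x m))) in Ht.
    apply Rmult_lt_reg_l with c; lra. }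
  exists l.
  assert (E : norm (minus (T l) y) = 0).
  { destruct (op_bound T) as [M [M0 HM]].
    pose proof (norm_geH (minus (T l) y)) as Hn0.
    destruct (Req_dec (norm (minus (T l) y)) 0) as [E|E]; [exact E|exfalso].
    set (k := norm (minus (T l) y)) in *.
    destruct (Hl (k / 2 / M)) as [N1 HN1]; [repeat apply Rdiv_lt_0_compat; lra|].
    destruct (harmonic_small (k / 2)) as [N2 HN2]; [lra|].
    specialize (HN1 _ (Nat.le_max_l N1 N2)). specialize (HN2 _ (Nat.le_max_r N1 N2)).
    set (n := Nat.max N1 N2) in *. specialize (Hx n).
    pose proof (norm_minus_triangle (T l) (T (x n)) y) as Ht. fold k in Ht.
    rewrite <- op_minus in Ht.
    specialize (HM (minus l (x n))). rewrite (norm_minus_sym l (x n)) in HM.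
    assert (M * norm (minus (x n) l) < k / 2).
    { replace (k / 2) with (M * (k / 2 / M)) by (field; lra).
      apply Rmult_lt_compat_l; lra. }
    lra. }
  apply norm_0_inv in E.
  replace y with (minus (T l) (minus (T l) y)) by hvec. rewrite E. hvec.
Qed.

(** The vector y is the sum of the series with terms 3^(-n) e_n, the sign of each
    being chosen so that the partial sum up to index n has an inner product of modulus
    at least 3^(-n) with e_n.  The later terms have total norm
    3^(-n) / 2, so at least half of this survives in the limit. *)
Lemma gliding_hump (e : nat -> H) : (forall n, norm (e n) = 1) ->
  exists y, forall n, (/ 3) ^ n / 2 <= Cmod (inner y (e n)).
Proof.
  intros He.
  pose (step := fun (n : nat) (y : H) =>
    if Rle_dec 0 (Re (inner y (e n)))
    then plus y (scal (RtoC ((/ 3) ^ n)) (e n))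
    else minus y (scal (RtoC ((/ 3) ^ n)) (e n))).
  pose (w := nat_rect (fun _ => H : Type) zero step : nat -> H).
  assert (P3 : forall n, 0 < (/ 3) ^ n) by (intros; apply pow_lt; lra).
  assert (Hsc : forall n, norm (scal (RtoC ((/ 3) ^ n)) (e n)) = (/ 3) ^ n).
  { intros n. specialize (P3 n).
    rewrite norm_scalH, Cmod_R, Rabs_pos_eq, He by lra. ring. }
  assert (Hw1 : forall n, norm (minus (w (S n)) (w n)) = (/ 3) ^ n).
  { intros n. change (w (S n)) with (step n (w n)). unfold step.
    transitivity (norm (scal (RtoC ((/ 3) ^ n)) (e n))); [|apply Hsc].
    destruct Rle_dec.
    - f_equal. hvec.
    - rewrite <- norm_oppH. f_equal. hvec. }
  assert (Hin : forall n, Re (inner (scal (RtoC ((/ 3) ^ n)) (e n)) (e n)) = (/ 3) ^ n).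
  { intros n. rewrite inner_scal_l, inner_norm, He. simpl. ring. }
  assert (Hw2 : forall n, (/ 3) ^ n <= Rabs (Re (inner (w (S n)) (e n)))).
  { intros n. change (w (S n)) with (step n (w n)). unfold step.
    specialize (Hin n). specialize (P3 n).
    destruct Rle_dec as [h|h].
    - rewrite inner_plus_l.
      change (Re (inner (w n) (e n) + inner (scal (RtoC ((/ 3) ^ n)) (e n)) (e n))%C)
        with (Re (inner (w n) (e n)) + Re (inner (scal (RtoC ((/ 3) ^ n)) (e n)) (e n))).
      rewrite Hin, Rabs_pos_eq; lra.
    - rewrite inner_minus_l.
      change (Re (inner (w n) (e n) - inner (scal (RtoC ((/ 3) ^ n)) (e n)) (e n))%C)
        with (Re (inner (w n) (e n)) - Re (inner (scal (RtoC ((/ 3) ^ n)) (e n)) (e n))).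
      rewrite Hin, Rabs_left; lra. }
  assert (Hw3 : forall n k, norm (minus (w (n + k)%nat) (w n))
    <= 3 / 2 * ((/ 3) ^ n - (/ 3) ^ (n + k))).
  { intros n k. induction k as [|k IH].
    - rewrite Nat.add_0_r, Rminus_diag, Rmult_0_r. apply Req_le.
      rewrite minus_diag. exact (norm_zero (V := H)).
    - rewrite Nat.add_succ_r.
      pose proof (norm_minus_triangle (w (S (n + k))) (w (n + k)%nat) (w n)) as Ht.
      rewrite Hw1 in Ht. change ((/ 3) ^ S (n + k)) with (/ 3 * (/ 3) ^ (n + k)). lra. }
  destruct (hilbert_complete w) as [y Hy].
  { intros eps Heps.
    destruct (pow_lt_1_zero (/ 3) ltac:(rewrite Rabs_pos_eq; lra) (eps / 3)
      ltac:(lra)) as [N HN].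
    exists N. intros n m Hn Hm. specialize (HN N (le_n N)).
    rewrite Rabs_pos_eq in HN by (specialize (P3 N); lra).
    pose proof (Hw3 N (n - N)%nat) as H1. pose proof (Hw3 N (m - N)%nat) as H2.
    replace (N + (n - N))%nat with n in H1 by lia.
    replace (N + (m - N))%nat with m in H2 by lia.
    pose proof (norm_minus_triangle (w n) (w N) (w m)) as Ht.
    rewrite (norm_minus_sym (w N)) in Ht.
    pose proof (P3 n). pose proof (P3 m). lra. }
  exists y. intros n.
  assert (Hyn : norm (minus y (w (S n))) <= (/ 3) ^ n / 2).
  { apply Rnot_lt_le. intros Hlt.
    destruct (Hy (norm (minus y (w (S n))) - (/ 3) ^ n / 2)) as [N HN]; [lra|].
    specialize (HN (S n + N)%nat ltac:(lia)).
    pose proof (Hw3 (S n) N) as H1.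
    pose proof (norm_minus_triangle y (w (S n + N)%nat) (w (S n))) as Ht.
    rewrite (norm_minus_sym y (w (S n + N)%nat)) in Ht.
    pose proof (P3 (S n + N)%nat). change ((/ 3) ^ S n) with (/ 3 * (/ 3) ^ n) in H1.
    lra. }
  eapply Rle_trans; [|apply re_le_Cmod].
  pose proof (cauchy_schwarz (minus y (w (S n))) (e n)) as Hcs.
  rewrite He, Rmult_1_r, inner_minus_l in Hcs.
  pose proof (re_le_Cmod (inner y (e n) - inner (w (S n)) (e n))%C) as Hre.
  change (Re (inner y (e n) - inner (w (S n)) (e n))%C)
    with (Re (inner y (e n)) - Re (inner (w (S n)) (e n))) in Hre.
  pose proof (Rabs_triang_inv (Re (inner (w (S n)) (e n))) (Re (inner y (e n)))) as Hi.
  rewrite Rabs_minus_sym in Hi. specialize (Hw2 n). lra.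
Qed.

(** If unit vectors e_n had images of norm at most 4^(-n) under the adjoint, then each
    y = T x would satisfy |<y, e_n>| <= |x| 4^(-n), against [gliding_hump]. *)
Lemma surjective_adjoint_bounded_below T : (forall y, exists x, T x = y) ->
  bounded_below (adjoint T).
Proof.
  intros Hs. apply NNPP. intros Hn.
  assert (He : forall n : nat, exists e, norm e = 1 /\
    norm (adjoint T e) <= (/ 4) ^ n).
  { intros n. apply NNPP. intros Hne. apply Hn. exists ((/ 4) ^ n).
    assert (P4 : 0 < (/ 4) ^ n) by (apply pow_lt; lra).
    split; [assumption|]. intros x. apply Rnot_lt_le. intros Hlt.
    pose proof (norm_geH x) as x0. pose proof (norm_geH (adjoint T x)) as Tx0.
    assert (x1 : norm x <> 0) by (intros E; rewrite E in Hlt; lra).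
    assert (Hsc : forall z, norm (scal (RtoC (/ norm x)) z) = / norm x * norm z).
    { intros z. assert (i0 : 0 < / norm x) by (apply Rinv_0_lt_compat; lra).
      now rewrite norm_scalH, Cmod_R, Rabs_pos_eq by lra. }
    apply Hne. exists (scal (RtoC (/ norm x)) x). split.
    - rewrite Hsc. field. assumption.
    - rewrite op_scal, Hsc. apply Rmult_le_reg_l with (norm x); [lra|].
      rewrite <- Rmult_assoc, Rinv_r, Rmult_1_l by assumption. lra. }
  apply functional_choice in He. destruct He as [e He].
  destruct (gliding_hump e) as [y Hy]; [intros n; apply He|].
  destruct (Hs y) as [x Ex].
  pose proof (norm_geH x) as x0.
  destruct (Pow_x_infinity (4 / 3) ltac:(rewrite Rabs_pos_eq; lra)
    (2 * norm x + 1)) as [N HN].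
  specialize (HN N (le_n N)). specialize (Hy N).
  rewrite Rabs_pos_eq in HN by (apply pow_le; lra).
  rewrite <- Ex, adjoint_correct in Hy.
  pose proof (cauchy_schwarz x (adjoint T (e N))) as Hcs.
  destruct (He N) as [_ HeN].
  assert (P4 : 0 < (/ 4) ^ N) by (apply pow_lt; lra).
  assert (E34 : (/ 3) ^ N = (4 / 3) ^ N * (/ 4) ^ N).
  { rewrite <- Rpow_mult_distr. f_equal. field. }
  rewrite E34 in Hy.
  assert (norm x * norm (adjoint T (e N)) <= norm x * (/ 4) ^ N)
    by now apply Rmult_le_compat_l.
  nra.
Qed.

(** * Domination *)

(** The factor [norm x] makes the relation homogeneous; it is the form in which
    |Im <g x, x>| <= |g x| |x| delivers estimates. *)
Definition dominated (f g : H -> H) : Prop :=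
  exists K, 0 < K /\ forall x, norm (f x) ^ 2 <= K * norm (g x) * norm x.

Lemma dominated_kernel f g :
  dominated f g -> kernel_trivial f -> kernel_trivial g.
Proof.
  intros [K [K0 HK]] Hf x Hx. apply Hf, norm_0_inv.
  specialize (HK x). pose proof (norm_geH (f x)).
  rewrite Hx in HK.
  replace (norm (zero : H)) with 0 in HK by (symmetry; exact (norm_zero (V := H))).
  nra.
Qed.

Lemma bounded_below_kernel (f : H -> H) : bounded_below f -> kernel_trivial f.
Proof.
  intros [c [c0 Hc]] x Hx. apply norm_0_inv. specialize (Hc x). rewrite Hx in Hc.
  replace (norm (zero : H)) with 0 in Hc by (symmetry; exact (norm_zero (V := H))).
  pose proof (norm_geH x). nra.
Qed.

Lemma dominated_bounded_below f g : dominated f g -> bounded_below f -> bounded_below g.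
Proof.
  intros [K [K0 HK]] [c [c0 Hc]]. exists (c ^ 2 / K).
  split; [apply Rdiv_lt_0_compat; nra|]. intros x.
  specialize (HK x). specialize (Hc x). pose proof (norm_geH x).
  pose proof (norm_geH (g x)).
  destruct (Req_dec (norm x) 0) as [->|Hx]; [lra|].
  assert (Hsq : (c * norm x) ^ 2 <= K * norm (g x) * norm x).
  { eapply Rle_trans; [|exact HK]. apply pow_incr. nra. }
  assert (c ^ 2 * norm x <= K * norm (g x)).
  { apply Rmult_le_reg_r with (norm x); [lra|]. lra. }
  apply Rmult_le_reg_l with K; [lra|].
  replace (K * (c ^ 2 / K * norm x)) with (c ^ 2 * norm x) by (field; lra). lra.
Qed.

(** Polarization bounds |<S x, y>| by k (q x + q y), where q is the quadratic form
    of Im T; taking y = t S x with t of order 1 / (k |T|) absorbs the q y term. *)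
Lemma numerical_domination S T k : 0 < k ->
  (forall u, Cmod (inner (S u) u) <= k * Im (inner (T u) u)) ->
  exists K, 0 < K /\ forall x, norm (S x) ^ 2 <= K * Im (inner (T x) x).
Proof.
  intros k0 Hk.
  assert (expand : forall (R : BOp H) x y (c : C),
    inner (R (plus x (scal c y))) (plus x (scal c y)) =
    (inner (R x) x + Cconj c * inner (R x) y + c * inner (R y) x
      + c * Cconj c * inner (R y) y)%C).
  { intros R x y c. rewrite op_plus, op_scal, inner_plus_l, inner_scal_l,
      !inner_plus_r, !inner_scal_r. ring. }
  pose (q := fun u => Im (inner (T u) u)).
  assert (q0 : forall u, 0 <= q u).
  { intros u. specialize (Hk u). pose proof (Cmod_ge_0 (inner (S u) u)).
    unfold q. nra. }
  (* The parallelogram law for q gives sum over k of q (x + i^k y) = 4 (q x + q y). *)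
  assert (pol : forall x y, Cmod (inner (S x) y) <= k * (q x + q y)).
  { intros x y.
    pose proof (Hk (plus x (scal (RtoC 1) y))) as H1.
    pose proof (Hk (plus x (scal (RtoC (-1)) y))) as H2.
    pose proof (Hk (plus x (scal Ci y))) as H3.
    pose proof (Hk (plus x (scal (- Ci)%C y))) as H4.
    rewrite !expand in H1, H2, H3, H4.
    set (a := inner (S x) x) in *. set (b := inner (S x) y) in *.
    set (c := inner (S y) x) in *. set (d := inner (S y) y) in *.
    set (A1 := (a + Cconj (RtoC 1) * b + RtoC 1 * c + RtoC 1 * Cconj (RtoC 1) * d)%C) in *.
    set (A2 := (a + Cconj (RtoC (-1)) * b + RtoC (-1) * c
                 + RtoC (-1) * Cconj (RtoC (-1)) * d)%C) in *.
    set (A3 := (a + Cconj Ci * b + Ci * c + Ci * Cconj Ci * d)%C) in *.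
    set (A4 := (a + Cconj (- Ci) * b + - Ci * c + - Ci * Cconj (- Ci) * d)%C) in *.
    assert (E : (RtoC 4 * b = A1 + - A2 + Ci * A3 + - (Ci * A4))%C).
    { unfold A1, A2, A3, A4. apply injective_projections; simpl; ring. }
    assert (B : 4 * Cmod b <= Cmod A1 + Cmod A2 + Cmod A3 + Cmod A4).
    { replace (4 * Cmod b) with (Cmod (RtoC 4 * b)%C)
        by (rewrite Cmod_mult, Cmod_R, Rabs_pos_eq; lra).
      rewrite E.
      pose proof (Cmod_triangle (A1 + - A2 + Ci * A3) (- (Ci * A4))) as t1.
      pose proof (Cmod_triangle (A1 + - A2) (Ci * A3)) as t2.
      pose proof (Cmod_triangle A1 (- A2)) as t3.
      rewrite Cmod_opp, Cmod_mult, Cmod_Ci in t1. rewrite Cmod_mult, Cmod_Ci in t2.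
      rewrite Cmod_opp in t3. lra. }
    unfold q. simpl in H1, H2, H3, H4. unfold Im, Re in *. lra. }
  destruct (op_bound T) as [M [M0 HM]].
  assert (qM : forall y, q y <= M * norm y ^ 2).
  { intros y. unfold q.
    pose proof (Im_le_Cmod (inner (T y) y)) as Hi. apply Rabs_le_between in Hi.
    pose proof (cauchy_schwarz (T y) y). specialize (HM y).
    pose proof (norm_geH y). nra. }
  exists (4 * k ^ 2 * M). split; [apply Rmult_lt_0_compat; nra|]. intros x.
  set (n := norm (S x)).
  (* This t makes the term k * q (t S x) at most half of t * n ^ 2. *)
  set (t := / (2 * k * M)).
  assert (t0 : 0 < t) by (apply Rinv_0_lt_compat; nra).
  pose proof (pol x (scal (RtoC t) (S x))) as Hp.
  rewrite inner_scal_r, inner_norm, Cmod_mult, Cmod_conj, !Cmod_R in Hp.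
  rewrite !Rabs_pos_eq in Hp by (try lra; apply pow2_ge_0). fold n in Hp.
  pose proof (qM (scal (RtoC t) (S x))) as Hq.
  rewrite norm_scal_sqr, Cmod_R, Rabs_pos_eq in Hq by lra. fold n in Hq.
  fold (q x).
  assert (Ht : t * (2 * k * M) = 1) by (unfold t; apply Rinv_l; nra).
  assert (Hmain : t * n ^ 2 <= k * q x + t * n ^ 2 / 2).
  { assert (k * q (scal (RtoC t) (S x)) <= t * n ^ 2 / 2).
    { replace (t * n ^ 2 / 2) with (k * (M * (t ^ 2 * n ^ 2))).
      - apply Rmult_le_compat_l; lra.
      - replace (k * (M * (t ^ 2 * n ^ 2))) with (t * n ^ 2 / 2 * (t * (2 * k * M)))
          by field. rewrite Ht. ring. }
    lra. }
  apply Rmult_le_reg_l with (t / 2); [lra|].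
  replace (t / 2 * (4 * k ^ 2 * M * q x)) with (t * (2 * k * M) * (k * q x)) by field.
  rewrite Ht. lra.
Qed.

(** * Dissipative operators at a real point *)

Lemma inner_im_op T x : inner (im_op T x) x = RtoC (Im (inner (T x) x)).
Proof.
  change (im_op T x) with (scal (/ (2 * Ci))%C (minus (T x) (adjoint T x))).
  rewrite inner_scal_l, inner_minus_l, (inner_conj _ x (adjoint T x)).
  rewrite <- adjoint_correct.
  apply injective_projections; simpl; unfold Im; field.
Qed.

Lemma norm_adjoint_diff T x :
  norm (minus (T x) (adjoint T x)) = 2 * norm (im_op T x).
Proof.
  change (im_op T x) with (scal (/ (2 * Ci))%C (minus (T x) (adjoint T x))).
  set (v := minus (T x) (adjoint T x)).
  rewrite norm_scalH, Cmod_inv, Cmod_mult, Cmod_Ci, Cmod_R, Rabs_pos_eq; [field|lra|].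
  intros E0. apply (f_equal snd) in E0. simpl in E0. lra.
Qed.

Definition im_nonneg T : Prop := forall x, 0 <= Im (inner (T x) x).

Lemma im_op_bound T : im_nonneg T ->
  exists K, 0 < K /\ forall x, norm (im_op T x) ^ 2 <= K * Im (inner (T x) x).
Proof.
  intros HT. apply (numerical_domination (im_op T) T 1); [lra|]. intros u.
  rewrite inner_im_op, Cmod_R, Rabs_pos_eq, Rmult_1_l; [lra|apply HT].
Qed.

(** The difference of T and its adjoint is 2 i Im T, and |Im T x|^2 is bounded by
    Im <T x, x>, which is at most |T x| |x| and also at most |T^* x| |x|. *)
Lemma adjoint_dominated T : im_nonneg T ->
  dominated (adjoint T) T /\ dominated T (adjoint T).
Proof.
  intros HT. destruct (im_op_bound T HT) as [K [K0 HK]].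
  destruct (op_bound T) as [M [M0 HM]].
  destruct (op_bound (adjoint T)) as [N [N0 HN]].
  assert (q1 : forall x, Im (inner (T x) x) <= norm (T x) * norm x).
  { intros x. eapply Rle_trans; [|apply cauchy_schwarz].
    eapply Rle_trans; [apply Rle_abs|apply Im_le_Cmod]. }
  assert (q2 : forall x, Im (inner (T x) x) <= norm (adjoint T x) * norm x).
  { intros x. rewrite adjoint_correct, Rmult_comm.
    eapply Rle_trans; [|apply cauchy_schwarz].
    eapply Rle_trans; [apply Rle_abs|apply Im_le_Cmod]. }
  assert (tri : forall x, norm (adjoint T x) ^ 2 <=
      2 * norm (T x) ^ 2 + 8 * (K * Im (inner (T x) x)) /\
    norm (T x) ^ 2 <=
      2 * norm (adjoint T x) ^ 2 + 8 * (K * Im (inner (T x) x))).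
  { intros x. specialize (HK x). pose proof (norm_adjoint_diff T x) as E.
    set (v := minus (T x) (adjoint T x)) in *.
    pose proof (norm_triangle_minusH (T x) v) as t1.
    pose proof (norm_triangleH (adjoint T x) v) as t2.
    replace (minus (T x) v) with (adjoint T x) in t1 by (unfold v; hvec).
    replace (plus (adjoint T x) v) with (T x) in t2 by (unfold v; hvec).
    rewrite E in t1, t2.
    pose proof (norm_geH (T x)). pose proof (norm_geH (adjoint T x)).
    pose proof (pow2_ge_0 (norm (T x) - 2 * norm (im_op T x))).
    pose proof (pow2_ge_0 (norm (adjoint T x) - 2 * norm (im_op T x))).
    pose proof (pow_incr _ _ 2 (conj (norm_geH (adjoint T x)) t1)).
    pose proof (pow_incr _ _ 2 (conj (norm_geH (T x)) t2)).
    split; lra. }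
  split; [exists (2 * M + 8 * K)|exists (2 * N + 8 * K)]; (split; [lra|]);
    intros x; destruct (tri x) as [t1 t2]; specialize (q1 x); specialize (q2 x);
    specialize (HM x); specialize (HN x);
    pose proof (norm_geH (T x)); pose proof (norm_geH (adjoint T x)); nra.
Qed.

Lemma shift_linear T (a : C) : is_linear (op_shift T a).
Proof.
  destruct (op_bound T) as [M [M0 HM]].
  assert (add : forall x y,
    op_shift T a (plus x y) = plus (op_shift T a x) (op_shift T a y)).
  { intros x y. unfold op_shift. rewrite op_plus. hvec. }
  assert (hom : forall (k : C) x, op_shift T a (scal k x) = scal k (op_shift T a x)).
  { intros k x. unfold op_shift. rewrite op_scal. hvec. }
  split; [exact add|exact hom|].
  exists (M + Cmod a). pose proof (Cmod_ge_0 a). split; [lra|]. intros x.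
  eapply Rle_trans; [apply norm_triangle_minusH|]. specialize (HM x).
  rewrite norm_scalH. lra.
Qed.

Lemma diff_linear S T : is_linear (fun x => minus (S x) (T x)).
Proof.
  destruct (op_bound S) as [M [M0 HM]]. destruct (op_bound T) as [N [N0 HN]].
  pose (D := (fun x => minus (S x) (T x)) : H -> H).
  assert (add : forall x y, D (plus x y) = plus (D x) (D y)).
  { intros x y. unfold D. rewrite !op_plus. hvec. }
  assert (hom : forall (k : C) x, D (scal k x) = scal k (D x)).
  { intros k x. unfold D. rewrite !op_scal. hvec. }
  split; [exact add|exact hom|].
  exists (M + N). split; [lra|]. intros x. specialize (HM x). specialize (HN x).
  eapply Rle_trans; [apply norm_triangle_minusH|]. lra.
Qed.

Definition diff S T : BOp H := Build_BOp H _ (diff_linear S T).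

Definition shift T (a : C) : BOp H := Build_BOp H _ (shift_linear T a).

Lemma im_inner_shift T (a : R) x :
  Im (inner (op_shift T (RtoC a) x) x) = Im (inner (T x) x).
Proof.
  unfold op_shift. rewrite inner_minus_l, inner_scal_l, inner_norm.
  simpl. unfold Im. ring.
Qed.

Lemma op_shift_0 T x : op_shift T (RtoC 0) x = T x.
Proof. unfold op_shift. hvec. Qed.

Lemma point_spectrum_kernel T a :
  point_spectrum T a <-> ~ kernel_trivial (op_shift T a).
Proof.
  unfold op_shift. split.
  - intros [x [Hx E]] Hk. apply Hx, Hk. rewrite E. hvec.
  - intros Hk. apply NNPP. intros Hn. apply Hk. intros x Hx.
    apply NNPP. intros Hx0. apply Hn. exists x. split; [assumption|].
    replace (T x) with (plus (minus (T x) (scal a x) : H) (scal a x)) by hvec.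
    rewrite Hx. hvec.
Qed.

Section RealPoint.
Context (T : BOp H) (a : R) (HT : im_nonneg T).

Lemma shift_im_nonneg : im_nonneg (shift T (RtoC a)).
Proof. intros x. simpl. rewrite im_inner_shift. apply HT. Qed.

(** The adjoint of T - a is injective along with T - a, being dominating. *)
Lemma kernel_trivial_dense : kernel_trivial (op_shift T (RtoC a)) ->
  forall y eps, 0 < eps -> exists x, norm (minus (op_shift T (RtoC a) x) y) < eps.
Proof.
  intros Hk. apply (dense_range (shift T (RtoC a))).
  destruct (adjoint_dominated _ shift_im_nonneg) as [_ D].
  exact (dominated_kernel _ _ D Hk).
Qed.

Lemma surjective_bounded_below : (forall y, exists x, op_shift T (RtoC a) x = y) ->
  bounded_below (op_shift T (RtoC a)).
Proof.
  intros Hs. destruct (adjoint_dominated _ shift_im_nonneg) as [D _].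
  exact (dominated_bounded_below _ _ D
    (surjective_adjoint_bounded_below (shift T (RtoC a)) Hs)).
Qed.

Lemma bounded_below_onto : bounded_below (op_shift T (RtoC a)) ->
  forall y, exists x, op_shift T (RtoC a) x = y.
Proof.
  intros Hb. apply (bounded_below_surjective (shift T (RtoC a)) Hb).
  now apply kernel_trivial_dense, bounded_below_kernel.
Qed.

Lemma continuous_spectrum_iff : continuous_spectrum T (RtoC a) <->
  kernel_trivial (op_shift T (RtoC a)) /\ ~ bounded_below (op_shift T (RtoC a)).
Proof.
  split.
  - intros [Hk [_ [y Hy]]]. split; [exact Hk|]. intros Hb.
    destruct (bounded_below_onto Hb y) as [x Hx]. exact (Hy x Hx).
  - intros [Hk Hb]. split; [exact Hk|split].
    + intros y eps. apply kernel_trivial_dense; [exact Hk|apply cond_pos].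
    + apply NNPP. intros Hn. apply Hb, surjective_bounded_below. intros y.
      apply NNPP. intros Hy. apply Hn. exists y. intros x Hx. apply Hy. now exists x.
Qed.

Lemma resolvent_set_iff : resolvent_set T (RtoC a) <->
  bounded_below (op_shift T (RtoC a)).
Proof.
  split.
  - intros [S [_ HS]]. apply surjective_bounded_below. intros y. now exists (S y).
  - intros Hb. pose proof (bounded_below_kernel _ Hb) as Hk.
    destruct (functional_choice _ (bounded_below_onto Hb)) as [g Hg].
    set (B := shift T (RtoC a)).
    change (forall y, B (g y) = y) in Hg.
    assert (inj : forall x x', B x = B x' -> x = x').
    { intros x x' E. assert (E0 : minus x x' = zero).
      { apply Hk. change (B (minus x x') = zero). rewrite op_minus, E.
        apply minus_diag. }
      replace x with (plus (minus x x' : H) x') by hvec. rewrite E0. hvec. }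
    assert (lin : is_linear g).
    { split.
      - intros x y. apply inj. now rewrite op_plus, !Hg.
      - intros k x. apply inj. now rewrite op_scal, !Hg.
      - destruct Hb as [c [c0 Hc]]. exists (/ c). 
        split; [now apply Rinv_0_lt_compat|]. intros y.
        specialize (Hc (g y)). change (op_shift T (RtoC a) (g y)) with (B (g y)) in Hc.
        rewrite Hg in Hc. apply Rmult_le_reg_l with c; [assumption|].
        rewrite <- Rmult_assoc, Rinv_r, Rmult_1_l by lra. exact Hc. }
    exists (Build_BOp H g lin). split; [|exact Hg].
    intros x. apply inj. exact (Hg _).
Qed.

End RealPoint.

(** Both properties that decide the spectral type are carried along by
    domination. *)
Lemma spectral_type_constant (T : C -> BOp H) (a : R) (z0 : C) :
  (forall z : C, 0 < Im z -> im_nonneg (T z)) ->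
  (forall z w : C, 0 < Im z -> 0 < Im w ->
     dominated (op_shift (T z) (RtoC a)) (op_shift (T w) (RtoC a))) ->
  0 < Im z0 ->
  (point_spectrum (T z0) (RtoC a) <->
     (forall z : C, 0 < Im z -> point_spectrum (T z) (RtoC a))) /\
  (continuous_spectrum (T z0) (RtoC a) <->
     (forall z : C, 0 < Im z -> continuous_spectrum (T z) (RtoC a))) /\
  (resolvent_set (T z0) (RtoC a) <->
     (forall z : C, 0 < Im z -> resolvent_set (T z) (RtoC a))).
Proof.
  intros HT HD h0.
  assert (ker : forall z w : C, 0 < Im z -> 0 < Im w ->
    kernel_trivial (op_shift (T z) (RtoC a)) ->
    kernel_trivial (op_shift (T w) (RtoC a))).
  { intros z w hz hw. exact (dominated_kernel _ _ (HD z w hz hw)). }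
  assert (bb : forall z w : C, 0 < Im z -> 0 < Im w ->
    bounded_below (op_shift (T z) (RtoC a)) ->
    bounded_below (op_shift (T w) (RtoC a))).
  { intros z w hz hw. exact (dominated_bounded_below _ _ (HD z w hz hw)). }
  split; [|split]; (split; [intros Hp z hz|intros Hall; now apply Hall]).
  - rewrite point_spectrum_kernel in *. eauto.
  - rewrite continuous_spectrum_iff in Hp |- * by auto. destruct Hp. split; eauto.
  - rewrite resolvent_set_iff in Hp |- * by auto. eauto.
Qed.

(** * Operator functions of class R *)

Lemma quadratic_form_nevanlinna (F : C -> BOp H) u :
  class_R F -> nevanlinna (fun z : C => inner (F z u) u).
Proof.
  intros HF. split.
  - intros z hz. destruct (class_R_holomorphic _ HF z ltac:(lra)) as [D HD].
    exists (inner (D u) u). apply cderivP. intros eps He.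
    set (n := norm u). assert (n0 : 0 <= n) by apply norm_geH.
    assert (He' : 0 < eps / (n ^ 2 + 1)) by (apply Rdiv_lt_0_compat; nra).
    destruct (HD (mkposreal _ He')) as [dl Hdl].
    exists dl. split; [apply cond_pos|]. intros w Hw.
    specialize (Hdl w Hw u). simpl in Hdl. fold n in Hdl.
    rewrite <- inner_scal_l, <- !inner_minus_l.
    eapply Rle_trans; [apply cauchy_schwarz|]. fold n.
    pose proof (Cmod_ge_0 (w - z)%C) as c0.
    eapply Rle_trans; [apply Rmult_le_compat_r; [exact n0|exact Hdl]|].
    replace (eps / (n * (n * 1) + 1) * Cmod (w - z) * n * n)
      with (eps * Cmod (w - z) * (n ^ 2 / (n ^ 2 + 1))) by (field; nra).
    rewrite <- (Rmult_1_r (eps * Cmod (w - z))) at 2.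
    apply Rmult_le_compat_l; [nra|].
    apply Rmult_le_reg_r with (n ^ 2 + 1); [nra|].
    unfold Rdiv. rewrite Rmult_assoc, Rinv_l by nra. lra.
  - intros z hz. destruct (class_R_dissipative _ HF z hz u) as [_ Hd].
    now rewrite inner_im_op in Hd.
Qed.

Lemma operator_harnack (F : C -> BOp H) (z w : C) : class_R F -> 0 < Im z -> 0 < Im w ->
  exists K, 0 < K /\ forall u,
    Cmod (inner (F z u) u - inner (F w u) u)%C <= K * Im (inner (F w u) u).
Proof.
  intros HF hz hw. destruct (nevanlinna_harnack z w hz hw) as [K [K0 HK]].
  exists (K + 1). split; [lra|]. intros u.
  pose proof (quadratic_form_nevanlinna F u HF) as HN.
  specialize (HK _ HN). destruct HN as [_ HN]. specialize (HN w hw). simpl in *. lra.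
Qed.

(** Here |Im F(z) x|^2 is at most a multiple of <Im F(z) x, x>, Harnack replaces z
    by w, and <Im F(w) x, x> <= |Im F(w) x| |x|. *)
Lemma im_op_dominated (F : C -> BOp H) (z w : C) : class_R F -> 0 < Im z -> 0 < Im w ->
  dominated (im_op (F z)) (im_op (F w)).
Proof.
  intros HF hz hw. destruct (operator_harnack F z w HF hz hw) as [k [k0 Hk]].
  destruct (im_op_bound (F z)) as [K [K0 HK]].
  { intros x. now apply (quadratic_form_nevanlinna F x HF). }
  exists (K * (1 + k)). split; [nra|]. intros x.
  eapply Rle_trans; [apply HK|]. rewrite !Rmult_assoc. apply Rmult_le_compat_l; [lra|].
  specialize (Hk x).
  pose proof (Rle_trans _ _ _ (Im_le_Cmod _) Hk) as Hi. apply Rabs_le_between in Hi.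
  change (Im (inner (F z x) x - inner (F w x) x)%C)
    with (Im (inner (F z x) x) - Im (inner (F w x) x)) in Hi.
  pose proof (rin_le (im_op (F w) x) x) as Hr. rewrite inner_im_op in Hr.
  change (Im (inner (F w x) x) <= norm (im_op (F w) x) * norm x) in Hr.
  apply (Rmult_le_compat_l (1 + k)) in Hr; lra.
Qed.

(** F(z) - a and F(w) - a differ by F(z) - F(w), whose square norm at x is controlled
    by Im <F(w) x, x> = Im <(F(w) - a) x, x>, a being real. *)
Lemma shift_dominated (F : C -> BOp H) (a : R) (z w : C) :
  class_R F -> 0 < Im z -> 0 < Im w ->
  dominated (op_shift (F z) (RtoC a)) (op_shift (F w) (RtoC a)).
Proof.
  intros HF hz hw. destruct (operator_harnack F z w HF hz hw) as [k [k0 Hk]].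
  destruct (numerical_domination (diff (F z) (F w)) (F w) k k0) as [K [K0 HK]].
  { intros u. simpl. rewrite inner_minus_l. apply Hk. }
  destruct (op_bound (shift (F w) (RtoC a))) as [M [M0 HM]].
  exists (2 * K + 2 * M). split; [lra|]. intros x.
  specialize (HK x). specialize (HM x). simpl in HK, HM.
  rewrite <- (im_inner_shift (F w) a) in HK.
  set (g := op_shift (F w) (RtoC a) x) in *.
  pose (d := minus (F z x) (F w x) : H). change (norm d ^ 2 <= K * Im (inner g x)) in HK.
  replace (op_shift (F z) (RtoC a) x) with (plus d g)
    by (unfold d, g, op_shift; hvec).
  pose proof (Rle_trans _ _ _ (Rle_trans _ _ _ (Rle_abs _) (Im_le_Cmod _))
    (cauchy_schwarz g x)) as Hi.
  pose proof (norm_geH (plus d g)) as n0. pose proof (norm_geH g) as g0.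
  pose proof (norm_geH x) as x0.
  pose proof (pow_incr _ _ 2 (conj n0 (norm_triangleH d g))) as Ht.
  pose proof (pow2_ge_0 (norm d - norm g)). 
  assert (norm g * norm g <= M * norm x * norm g) by now apply Rmult_le_compat_r.
  assert (K * Im (inner g x) <= K * (norm g * norm x))
    by (apply Rmult_le_compat_l; lra).
  lra.
Qed.

End Hilbert.

Theorem theorem1p2 (H : HilbertSpace) (Hsep : separable H)
    (F : C -> BOp H) (FR : class_R F)
    (z0 : C) (hz0 : 0 < Im z0) (a : R) :
  (point_spectrum (im_op (F z0)) (RtoC 0) <->
     (forall z : C, 0 < Im z -> point_spectrum (im_op (F z)) (RtoC 0))) /\
  (continuous_spectrum (im_op (F z0)) (RtoC 0) <->
     (forall z : C, 0 < Im z -> continuous_spectrum (im_op (F z)) (RtoC 0))) /\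
  (resolvent_set (im_op (F z0)) (RtoC 0) <->
     (forall z : C, 0 < Im z -> resolvent_set (im_op (F z)) (RtoC 0))) /\
  (point_spectrum (F z0) (RtoC a) <->
     (forall z : C, 0 < Im z -> point_spectrum (F z) (RtoC a))) /\
  (continuous_spectrum (F z0) (RtoC a) <->
     (forall z : C, 0 < Im z -> continuous_spectrum (F z) (RtoC a))) /\
  (resolvent_set (F z0) (RtoC a) <->
     (forall z : C, 0 < Im z -> resolvent_set (F z) (RtoC a))).
Proof.
  destruct (spectral_type_constant (fun z => im_op (F z)) 0 z0) as [P1 [P2 P3]].
  - intros z hz x. rewrite inner_im_op. simpl. lra.
  - intros z w hz hw. destruct (im_op_dominated F z w FR hz hw) as [K [K0 HK]].
    exists K. split; [assumption|]. intros x. rewrite !op_shift_0. apply HK.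
  - assumption.
  - destruct (spectral_type_constant F a z0) as [P4 [P5 P6]].
    + intros z hz x. now apply (quadratic_form_nevanlinna F x FR).
    + intros z w hz hw. now apply shift_dominated.
    + assumption.
    + exact (conj P1 (conj P2 (conj P3 (conj P4 (conj P5 P6))))).
Qed.
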